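(* Let $q$ be a prime power and let $\chi$ be a complex irreducible character of $\mathrm{PGL}_2(q)$. Then $\chi$ is not unisingular if and only if one of the following cases occurs: (1) $\chi$ is a nontrivial linear character; (2) $\chi(1)=q$ and $\chi$ is the Steinberg character of $\mathrm{PGL}_2(q)$; (3) $q$ is an odd prime and $\chi(1)=q-1$.
   Context: A complex representation $\Phi:G\to \mathrm{GL}_n(\mathbb{C})$ of a finite group $G$ is called unisingular if for every $g\in G$ the matrix $\Phi(g)$ has $1$ as an eigenvalue; a character is called unisingular if a representation affording it is unisingular. The Steinberg character of $\mathrm{PGL}_2(q)$ is the irreducible character of degree $q$ given by $g\mapsto f(g)-1$, where $f(g)$ is the number of points of the projective line over $\mathbb{F}_q$ fixed by $g$. *)

(* Defs.v *)
From mathcomp Require Import all_boot all_order all_algebra all_fingroup.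
From mathcomp Require Import all_solvable all_field all_character.

Set Implicit Arguments.
Unset Strict Implicit.
Unset Printing Implicit Defensive.

Import GRing.Theory GroupScope.
Local Open Scope ring_scope.

(* Complex representations and characters are taken over algC, the field of
   algebraic complex numbers, as in the library's character theory. *)
Definition unisingular_repr (gT : finGroupType) (G : {group gT}) (n : nat)
    (rG : mx_representation algC G n) : Prop :=
  forall g : gT, g \in G -> eigenvalue (rG g) 1.

Definition unisingular (gT : finGroupType) (G : {group gT})
    (chi : 'CF(G)) : Prop :=
  exists (n : nat) (rG : mx_representation algC G n),
    cfRepr rG = chi /\ unisingular_repr rG.

Lemma GL2_centerP (F : finFieldType) (A : {'GL_2[F]}) :
  reflect (exists a : F, GLval A = a%:M) (A \in 'Z('GL_2[F])%g).
Proof.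
apply: (iffP idP) => [/centerP[_ cA] | [a Aa]]; last first.
  apply/centerP; split=> [|B _]; first by rewrite inE.
  by apply: val_inj; change (GLval A *m GLval B = GLval B *m GLval A);
    rewrite Aa scalar_mxC.
have comm_delta (i j : 'I_2) : i != j ->
    GLval A *m delta_mx i j = delta_mx i j *m GLval A.
  move=> nij.
  have Eij2 : (delta_mx i j : 'M[F]_2) *m delta_mx i j = 0.
    by rewrite mul_delta_mx_cond eq_sym (negPf nij).
  have /mulmx1_unit[_ Uij] :
      (1%:M - delta_mx i j) *m (1%:M + delta_mx i j) = 1%:M :> 'M[F]_2.
    by rewrite mulmxDr mulmx1 mulmxBl mul1mx Eij2 subr0 subrK.
  have /(congr1 (@GLval 2 F)) := cA (Sub (1%:M + delta_mx i j) Uij) (in_setT _).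
  rewrite !GL_MxE /= mulmxDr mulmxDl mulmx1 mul1mx; exact: addrI.
have E01 := comm_delta 0 1 isT; have E10 := comm_delta 1 0 isT.
exists (GLval A 0 0).
have := congr1 (fun M : 'M_2 => M 0 1) E01.
have := congr1 (fun M : 'M_2 => M 0 0) E01.
have := congr1 (fun M : 'M_2 => M 0 0) E10.
rewrite !mxE !big_ord_recl !big_ord0 !mxE /=.
rewrite ?(mulr0, mulr1, mul0r, mul1r, addr0, add0r).
have <- : 1 = lift ord0 ord0 :> 'I_2 by apply: val_inj.
move=> A01 A10 A11; apply/matrixP=> i j; rewrite mxE.
have ordP (k : 'I_2) : k = 0 \/ k = 1.
  by case: k => [[|[]]] // ?; [left | right]; apply: val_inj.
by case: (ordP i) => ->; case: (ordP j) => ->; rewrite ?mulr1n ?mulr0n.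
Qed.

(* By GL2_centerP this is GL_2 modulo the scalar matrices. *)
Definition PGL2 (F : finFieldType) : {group coset_of 'Z('GL_2[F])} :=
  ('GL_2[F] / 'Z('GL_2[F]))%G.

(* Points are lines through the origin of F^2, as sets of row vectors; matrices
   act on the right, which is the convention for actions and for 'MR; as g and its
   transpose are conjugate, the number of fixed points is the same on columns. *)
Definition proj_line (F : finFieldType) : {set {set 'rV[F]_2}} :=
  [set [set a *: v | a : F] | v : 'rV[F]_2 & v != 0].

(* GLrepr F 1 is the natural representation of GL_2; proj_fixE makes the action
   of a coset explicit. *)
Definition proj_fix (F : finFieldType) (g : coset_of 'Z('GL_2[F])) :
    {set {set 'rV[F]_2}} :=
  'Fix_(proj_line F | ('MR (GLrepr F 1))^* %% 'Z('GL_2[F]))[g].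

Definition is_steinberg (F : finFieldType) (chi : 'CF(PGL2 F)) : Prop :=
  forall g, g \in PGL2 F -> chi g = #|proj_fix g|%:R - 1.

Lemma proj_fixE (F : finFieldType) (A : {'GL_2[F]}) :
  proj_fix (coset 'Z('GL_2[F]) A) =
    [set L in proj_line F | [set v *m GLval A | v in L] == L].
Proof.
have NA : A \in 'N('Z('GL_2[F])).
  by apply: (subsetP (normal_norm (center_normal _))); rewrite inE.
apply/setP=> L; rewrite !in_setI inE; case PL: (L \in _) => //=.
have actL (B : {'GL_2[F]}) :
    (('MR (GLrepr F 1))^*)%act L B = [set v *m GLval B | v in L].
  by apply: eq_imset => v; rewrite /= mx_repr_actE ?inE.
have fixL : L \in 'Fix_(('MR (GLrepr F 1))^*)('GL_2[F] :&: 'Z('GL_2[F])).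
  apply/afixP=> B /setIP[_ /GL2_centerP[b Bb]]; rewrite actL Bb.
  have b_neq0 : b != 0.
    apply: contraTneq (GL_unitmx B) => b0.
    by rewrite /= Bb b0 unitmxE det_scalar expr2 mul0r unitr0.
  case/imsetP: PL => v _ ->; apply/setP=> w.
  apply/imsetP/imsetP=> [[_ /imsetP[a _ ->] ->] | [a _ ->]].
    by exists (b * a) => //; rewrite mul_mx_scalar scalerA.
  exists ((b^-1 * a) *: v); first by apply/imsetP; exists (b^-1 * a).
  by rewrite mul_mx_scalar scalerA mulVKf.
rewrite !inE sub1set inE -actL; congr (_ == L).
by apply: modactE => //; rewrite inE.
Qed.

(* Main.v *)
Require Import Defs.
From mathcomp Require Import all_boot all_order all_algebra all_fingroup.
From mathcomp Require Import all_solvable all_field all_character.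
From mathcomp Require Import ring zify.

(** An element g of a finite group has the eigenvalue 1 in a complex representation
    if and only if the character does not sum to 0 over <[g]>; it is enough that the
    sum over some subgroup containing g is nonzero (eigenvalue1_sum, sum_cycle_neq0).
    So everything is decided by multiplicities of principal characters in
    restrictions. Inflate chi to a character psi of G = GL2(q), and write f for the
    number nfix of fixed points on the projective line.

    The three induced characters that are needed are polynomials in f: the principal
    characters of the Borel subgroup B, of the split torus T and of a nonsplit torus
    S induce f, f (f - 1) and (f - 1) (f - 2). These facts are the counting lemmas
    sum_nfix, sum_nfix2 and sum_nonsplit. The last one rests on the fact that the
    noncentral elements of S and of its conjugates are exactly the elliptic elements
    (f = 0), each of which commutes with exactly two conjugates of a given elliptic
    element.

    Nontrivial unipotents are all conjugate, so the restriction of psi to the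
    unipotent group U is a times the principal character plus d times the sum of the
    q - 1 other ones, and psi(1) = a + (q - 1) d. Let m be the multiplicity of the
    principal character of B. Computing on B gives the multiplicity m + d for T; if
    psi is not principal, the relation between the three polynomials then gives
    (m + d) - 2 m = d - m for S.

    Let psi be nonlinear. Then d > 0, because G modulo any normal subgroup containing
    U is abelian (linear_of_unip_trivial). So diagonalizable elements always have a
    fixed vector. If m > 0 then psi = f - 1 is the Steinberg character, since f has
    norm 2 (steinberg_of_borel); it has multiplicity 0 on the torus S, which is
    cyclic, so it is not unisingular. If m = 0 then elliptic elements have fixed
    vectors. There remain the unipotents: they have fixed vectors if a > 0, and also
    if a = 0 and q is not prime, because then the sum of the nontrivial characters of
    U contains the principal character of every cyclic subgroup of U. If a = 0 and q
    is prime they have none, and it remains to see that the degree (q - 1) d is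
    q - 1: the multiplicity d of a cuspidal character is at most 1
    (cuspidal_mult_le1). Conversely a nonlinear psi of degree q - 1 has a = 0. *)

Set Implicit Arguments.
Unset Strict Implicit.
Unset Printing Implicit Defensive.

Import Order.TTheory Num.Theory.
Import GRing.Theory GroupScope.
Local Open Scope ring_scope.

(** * Fixed vectors and sums of characters *)

(** A full rank factorization E = C R of an idempotent satisfies R C = 1, and the
    trace of E is that of R C. *)
Lemma mxtrace_idem (K : fieldType) n (E : 'M[K]_n) :
  E *m E = E -> \tr E = (\rank E)%:R.
Proof.
move=> EE; have RC1 : row_base E *m col_base E = 1%:M.
  have /row_fullP[L LC] := col_base_full E.
  have /row_freeP[M RM] := row_base_free E.
  have CR := mulmx_base E; move: (col_base E) (row_base E) CR LC RM => C R CR LC RM.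
  have : L *m (E *m E) *m M = L *m E *m M by rewrite EE.
  move: L M LC RM; move: (\rank E) C R CR => r C R CR L M LC RM.
  rewrite -CR !mulmxA LC mul1mx.
  by rewrite -!mulmxA RM !mulmx1.
by rewrite -{1}[E]mulmx_base mxtrace_mulC RC1 mxtrace1.
Qed.

Section FixedVectors.
Variables (gT : finGroupType) (G : {group gT}) (n : nat).
Variable rG : mx_representation algC G n.

(** The sum P of the rG h over H satisfies P rG(g) = P, so that every nonzero row
    of P is an eigenvector; and P is nonzero as soon as its trace is. *)
Lemma eigenvalue1_sum (H : {group gT}) (g : gT) :
    H \subset G -> g \in H -> \sum_(h in H) cfRepr rG h != 0 ->
  eigenvalue (rG g) 1.
Proof.
move=> sHG Hg trH.
have trE : \tr (\sum_(h in H) rG h) = \sum_(h in H) cfRepr rG h.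
  rewrite raddf_sum /=; apply: eq_bigr => h Hh.
  by rewrite cfunE (subsetP sHG) // mulr1n.
set P := \sum_(h in H) rG h in trE.
have Pg : P *m rG g = P.
  rewrite /P mulmx_suml [RHS](reindex_inj (mulIg g)) /=.
  rewrite [RHS](eq_bigl (mem H)) => [|h]; last by rewrite groupMr.
  by apply: eq_bigr => h Hh; rewrite repr_mxM ?(subsetP sHG).
have /rowV0Pn[v /submxP[w ->] nz] : P != 0.
  by apply: contraNneq trH => P0; rewrite -trE P0 mxtrace0.
by apply/eigenvalueP; exists (w *m P); rewrite // scale1r -mulmxA Pg.
Qed.

(** A vector fixed by g is fixed by all of <[g]>, hence by the averaging
    projection P, whose trace is its rank. *)
Lemma sum_cycle_neq0 (g : gT) :
  g \in G -> eigenvalue (rG g) 1 -> \sum_(h in <[g]>) cfRepr rG h != 0.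
Proof.
move=> Gg /eigenvalueP[v vg nz_v].
have sHG : <[g]> \subset G by rewrite cycle_subG.
pose P := #|<[g]>|%:R^-1 *: \sum_(h in <[g]>) rG h.
have nzH : #|<[g]>|%:R != 0 :> algC by rewrite pnatr_eq0 -lt0n cardG_gt0.
have Pg h : h \in <[g]> -> rG h *m P = P.
  move=> Hh; rewrite /P -scalemxAr; congr (_ *: _).
  rewrite mulmx_sumr [RHS](reindex_inj (mulgI h)) /=.
  rewrite [RHS](eq_bigl (mem <[g]>)) => [|k]; last by rewrite groupMl.
  by apply: eq_bigr => k Hk; rewrite repr_mxM ?(subsetP sHG).
have PP : P *m P = P.
  rewrite {1}/P -scalemxAl mulmx_suml (eq_bigr (fun=> P)) //.
  by rewrite sumr_const -[P in X in _ *: X]scale1r scalerMnl scalerA mulVf ?scale1r.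
have vP : v *m P = v.
  rewrite /P -scalemxAr mulmx_sumr (eq_bigr (fun=> v)) => [|_ /cycleP[k ->]].
    by rewrite sumr_const -[v in X in _ *: X]scale1r scalerMnl scalerA mulVf ?scale1r.
  elim: k => [|k IHk]; first by rewrite repr_mx1 mulmx1.
  by rewrite expgS repr_mxM ?groupX // mulmxA vg scale1r.
have trP : \tr P = #|<[g]>|%:R^-1 * \sum_(h in <[g]>) cfRepr rG h.
  rewrite /P mxtraceZ raddf_sum /=; congr (_ * _); apply: eq_bigr => h Hh.
  by rewrite cfunE (subsetP sHG) // mulr1n.
have: \tr P != 0.
  rewrite (mxtrace_idem PP) pnatr_eq0 mxrank_eq0.
  by apply: contraNneq nz_v => P0; rewrite -vP P0 mulmx0.
by rewrite trP mulf_eq0 negb_or => /andP[].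
Qed.

Lemma eigenvalue1J (g y : gT) :
  g \in G -> y \in G -> eigenvalue (rG (g ^ y)%g) 1 -> eigenvalue (rG g) 1.
Proof.
move=> Gg Gy /eigenvalueP[v vgy nz_v]; apply/eigenvalueP.
exists (v *m rG y^-1%g).
  rewrite scale1r -mulmxA -repr_mxM ?groupV //.
  have -> : (y^-1 * g = g ^ y * y^-1)%g by rewrite conjgE mulgA mulgK.
  by rewrite repr_mxM ?groupV ?groupJ // mulmxA vgy scale1r.
apply: contraNneq nz_v => v0.
by rewrite -[v]mulmx1 -(repr_mx1 rG) -(mulVg y) repr_mxM ?groupV // mulmxA v0 mul0mx.
Qed.

End FixedVectors.

Section CharSums.
Variables (gT : finGroupType) (G : {group gT}).

Lemma sum_char_nat (psi : 'CF(G)) (H : {group gT}) :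
  psi \is a character -> H \subset G ->
  exists n : nat, \sum_(h in H) psi h = #|H|%:R * n%:R.
Proof.
move=> Npsi sHG.
have /natrP[n En] : '['Res[H] psi, 1] \in Num.nat.
  by rewrite Cnat_cfdot_char ?cfRes_char ?rpred1.
exists n; rewrite -En cfdotE mulVKf; last by rewrite pnatr_eq0 -lt0n cardG_gt0.
by apply: eq_bigr => h Hh; rewrite cfun1E Hh rmorph1 mulr1 cfResE.
Qed.

Lemma sum_irr_neq1 (psi : 'CF(G)) :
  psi \in irr G -> psi != 1 -> \sum_(g in G) psi g = 0.
Proof.
case/irrP=> i -> ni1; have := cfdot_irr i 0.
rewrite irr0 -(inj_eq irr_inj) irr0 (negPf ni1) cfdotE => /eqP.
rewrite mulf_eq0 invr_eq0 pnatr_eq0 -[_ == 0]negbK -lt0n cardG_gt0 /= => /eqP E.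
by rewrite -[RHS]E; apply: eq_bigr => g Gg; rewrite cfun1E Gg rmorph1 mulr1.
Qed.

Lemma sum_irr_norm (psi : 'CF(G)) :
  psi \in irr G -> \sum_(g in G) psi g * (psi g)^* = #|G|%:R.
Proof.
case/irrP=> i ->; have := cfdot_irr i i; rewrite eqxx cfdotE.
by move/(canRL (mulVKf _))->; rewrite ?mulr1 // pnatr_eq0 -lt0n cardG_gt0.
Qed.

(** The coordinates of theta on the irreducible characters are integers n_i and,
    G being abelian, these all have degree 1; so theta 1 is the sum of the n_i,
    '[theta] the sum of their squares, and an integer is at most its square. *)
Lemma vchar_abelian_deg_le (theta : 'CF(G)) : abelian G ->
  theta \in 'Z[irr G] -> theta 1%g <= '[theta].
Proof.
move=> cGG Ztheta; rewrite (cfdot_vchar_r _ Ztheta) {1}(cfun_sum_cfdot theta).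
rewrite sum_cfunE; apply: ler_sum => i _; rewrite cfunE.
rewrite (lin_char1 (char_abelianP _ cGG i)) mulr1.
have /intrP[m ->] := Cint_cfdot_vchar_irr i Ztheta.
by rewrite -intrM ler_int; nia.
Qed.
End CharSums.

(** * Two by two matrices and the projective line *)

Section Matrices2.
Variable F : finFieldType.
Implicit Types (a b c d x : F) (A : 'M[F]_2) (g h y : {'GL_2[F]}).

Definition mx2 a b c d : 'M[F]_2 :=
  \matrix_(i, j) if i == 0 then (if j == 0 then a else b)
                 else (if j == 0 then c else d).

Lemma ord2P (i : 'I_2) : i = 0 \/ i = 1.
Proof. by case: i => [[|[]]] // ?; [left | right]; apply: val_inj. Qed.

Lemma mx2E A : A = mx2 (A 0 0) (A 0 1) (A 1 0) (A 1 1).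
Proof.
by apply/matrixP=> i j; rewrite mxE; case: (ord2P i) => ->; case: (ord2P j) => ->.
Qed.

Lemma mx2_entries a b c d :
  (mx2 a b c d 0 0 = a) * (mx2 a b c d 0 1 = b)
  * (mx2 a b c d 1 0 = c) * (mx2 a b c d 1 1 = d).
Proof. by rewrite !mxE. Qed.

Lemma sum_ord2 (V : zmodType) (f : 'I_2 -> V) : \sum_i f i = f 0 + f 1.
Proof.
rewrite !big_ord_recl big_ord0 addr0; congr (_ + f _).
exact: val_inj.
Qed.

Lemma mulmx2E m n (A : 'M[F]_(m, 2)) (B : 'M[F]_(2, n)) i j :
  (A *m B) i j = A i 0 * B 0 j + A i 1 * B 1 j.
Proof. by rewrite mxE sum_ord2. Qed.

Lemma mulmx2 a b c d a' b' c' d' :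
  mx2 a b c d *m mx2 a' b' c' d' =
  mx2 (a * a' + b * c') (a * b' + b * d') (c * a' + d * c') (c * b' + d * d').
Proof. by rewrite [LHS]mx2E !mulmx2E !mx2_entries. Qed.

Lemma det_mx2 a b c d : \det (mx2 a b c d) = a * d - b * c.
Proof.
rewrite (expand_det_row _ 0) sum_ord2 /cofactor !det_mx11 !mxE /=.
by rewrite !mulN1r ?mul1r ?addn0 ?expr0 ?expr1 ?mul1r ?mulN1r mulrN.
Qed.

Lemma scalar_mx2 a : a%:M = mx2 a 0 0 a.
Proof.
by apply/matrixP=> i j; rewrite !mxE; case: (ord2P i) => ->; case: (ord2P j) => ->.
Qed.

(** Restores the dimension 2, which the coercion GLval displays as 2.-1.+1. *)
Definition gmx g : 'M[F]_2 := GLval g.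

Lemma gmxM g h : gmx (g * h)%g = gmx g *m gmx h. Proof. by []. Qed.

Lemma gmx1 : gmx 1%g = 1%:M. Proof. by []. Qed.

Lemma gmx_inj : injective gmx. Proof. exact: val_inj. Qed.

Lemma gmx_unit g : gmx g \in unitmx.
Proof. exact: (GL_unit g). Qed.

Definition gl2 (a b c d : F) : {'GL_2[F]} :=
  odflt (1%g : {'GL_2[F]}) (insub (mx2 a b c d)).

Arguments gl2 (a b c d)%_R.

Lemma gl2K a b c d : a * d - b * c != 0 -> gmx (gl2 a b c d) = mx2 a b c d.
Proof. by move=> nz; rewrite /gl2 insubT ?unitmxE ?det_mx2 ?unitfE. Qed.

Lemma GL_det_neq0 g : gmx g 0 0 * gmx g 1 1 - gmx g 0 1 * gmx g 1 0 != 0.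
Proof. by rewrite -det_mx2 -mx2E -unitfE -unitmxE gmx_unit. Qed.

Lemma gl2E g : g = gl2 (gmx g 0 0) (gmx g 0 1) (gmx g 1 0) (gmx g 1 1).
Proof. by apply: gmx_inj; rewrite gl2K ?GL_det_neq0 // -mx2E. Qed.

Lemma Z_entriesP g : (g \in 'Z('GL_2[F])%g) =
  [&& gmx g 0 1 == 0, gmx g 1 0 == 0 & gmx g 0 0 == gmx g 1 1].
Proof.
apply/GL2_centerP/and3P=> [[a] | [/eqP b0 /eqP c0 /eqP ad]].
  rewrite -[GLval g]/(gmx g) => ->.
  by rewrite scalar_mx2 !mx2_entries !eqxx.
by exists (gmx g 0 0); rewrite -[GLval g]/(gmx g) scalar_mx2 [LHS]mx2E b0 c0 ad.
Qed.

(** The point None of the projective line is the line spanned by (1, 0), and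
    Some x is the line spanned by (x, 1). The matrix pt_rep p has the chosen
    spanning vector pt_vec p as its first row, so it moves the point None to p. *)
Definition pt_rep (p : option F) : {'GL_2[F]} :=
  if p is Some x then gl2 x 1 1 0 else 1%g.

Definition pt_vec p : 'rV[F]_2 := row 0 (gmx (pt_rep p)).

Definition fixes g p := (pt_vec p *m gmx g <= pt_vec p)%MS.
Definition fixpts g := [set p | fixes g p].
Definition nfix g := #|fixpts g|.

Lemma pt_repE p : gmx (pt_rep p) =
  if p is Some x then mx2 x 1 1 0 else 1%:M.
Proof.
by case: p => [x|] //=; rewrite gl2K // mulr0 mulr1 sub0r oppr_eq0 oner_eq0.
Qed.

Lemma pt_vecE p : (pt_vec p 0 0 = if p is Some x then x else 1)
                  * (pt_vec p 0 1 = if p is Some x then 1 else 0).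
Proof. by rewrite /pt_vec pt_repE; case: p => [x|]; rewrite !mxE. Qed.

Lemma rV2P (v w : 'rV[F]_2) : v 0 0 = w 0 0 -> v 0 1 = w 0 1 -> v = w.
Proof. by move=> v0 v1; apply/rowP=> i; case: (ord2P i) => ->. Qed.

Lemma pt_vec_neq0 p : pt_vec p != 0.
Proof.
have: gmx (pt_rep p) \in unitmx by exact: gmx_unit.
rewrite -row_free_unit => /row_free_inj inj_p.
rewrite /pt_vec rowE; apply/eqP; rewrite -[0 in RHS](mul0mx _ (gmx (pt_rep p))).
move/inj_p/rowP/(_ 0); rewrite !mxE /= => /eqP; by rewrite oner_eq0.
Qed.

Lemma fixes_None g : fixes g None = (gmx g 0 1 == 0).
Proof.
rewrite /fixes; apply/sub_rVP/eqP => [[a /rowP/(_ 1)] | b0].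
  by rewrite mulmx2E [RHS]mxE !pt_vecE mul1r mul0r addr0 mulr0.
exists (gmx g 0 0); apply: rV2P; rewrite mulmx2E [RHS]mxE !pt_vecE.
  by rewrite mul1r mul0r addr0 mulr1.
by rewrite b0 !(mulr0, mul0r) addr0.
Qed.

Lemma fixes_Some g x : fixes g (Some x) =
  (x * (x * gmx g 0 1 + gmx g 1 1) == x * gmx g 0 0 + gmx g 1 0).
Proof.
rewrite /fixes; apply/sub_rVP/eqP => [[a E] | E].
  have /rowP/(_ 1) := E; rewrite mulmx2E [RHS]mxE !pt_vecE !mul1r mulr1 => Ea.
  have /rowP/(_ 0) := E; rewrite mulmx2E [RHS]mxE !pt_vecE !mul1r -Ea => ->.
  by rewrite mulrC.
exists (x * gmx g 0 1 + gmx g 1 1).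
apply: rV2P; rewrite mulmx2E [RHS]mxE !pt_vecE !mul1r ?mulr1 //.
by rewrite -E mulrC.
Qed.

(** Lower triangular matrices: with the action on row vectors these are the ones
    that fix the point None. *)
Definition borel := [set g : {'GL_2[F]} | gmx g 0 1 == 0].

(** Stabilizers of points are conjugate: borel is the stabilizer of None, which
    pt_rep p moves to p. *)
Lemma fixes_borel g p : fixes g p = ((g ^ (pt_rep p)^-1)%g \in borel).
Proof.
have Up : gmx (pt_rep p)^-1%g \in unitmx by exact: gmx_unit.
rewrite /fixes -(@submxMfree _ _ _ _ _ _ _ (gmx (pt_rep p)^-1%g)) ?row_free_unit //.
have e0 h : row 0 (gmx h) = row 0 1%:M *m gmx h by rewrite -row_mul mul1mx.
have -> : pt_vec p *m gmx (pt_rep p)^-1%g = pt_vec None.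
  by rewrite /pt_vec e0 -mulmxA -gmxM mulgV.
rewrite -mulmxA -gmxM.
have -> : pt_vec p = row 0 1%:M *m gmx (pt_rep p) by exact: e0.
rewrite -mulmxA -gmxM inE -fixes_None /fixes /conjg invgK.
by rewrite {2}/pt_vec [pt_rep None]/= gmx1.
Qed.

End Matrices2.

Arguments gl2 {F} (a b c d)%_R.

Section Points.
Variable F : finFieldType.
Implicit Types (a b c d x : F) (g h y z : {'GL_2[F]}) (p : option F).

Definition pt_of (v : 'rV[F]_2) : option F :=
  if v 0 1 == 0 then None else Some (v 0 0 / v 0 1).

Lemma pt_ofP v : v != 0 -> exists2 a, a != 0 & v = a *: pt_vec (pt_of v).
Proof.
move=> nz_v; rewrite /pt_of; have [v1 | v1] := eqVneq (v 0 1) 0.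
  exists (v 0 0); last by apply: rV2P; rewrite mxE pt_vecE ?mulr1 // mulr0.
  by apply: contraNneq nz_v => v0; apply/eqP/rV2P; rewrite ?v0 ?v1 mxE.
exists (v 0 1) => //.
by apply: rV2P; rewrite mxE pt_vecE ?mulr1 // mulrC divfK.
Qed.

Lemma pt_of_eqmx v : v != 0 -> (pt_vec (pt_of v) :=: v)%MS.
Proof.
case/pt_ofP=> a nz_a {2}->; exact/eqmx_sym/eqmx_scale.
Qed.

Lemma pt_vec_inj p p' : (pt_vec p <= pt_vec p')%MS -> p = p'.
Proof.
case/sub_rVP=> a E; have nz := pt_vec_neq0 p.
have /rowP/(_ 0) := E; rewrite [RHS]mxE !pt_vecE => H0.
have /rowP/(_ 1) := E; rewrite [RHS]mxE !pt_vecE => H1.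
case: p p' H0 H1 {E nz} => [x|] [x'|] // H0 H1.
- by rewrite H0; rewrite mulr1 in H1; rewrite -H1 mul1r.
- by move/eqP: H1; rewrite mulr0 oner_eq0.
- by rewrite mulr1 in H1; move/eqP: H0; rewrite -H1 mul0r oner_eq0.
Qed.

Lemma fixes_pt_of g v : v != 0 -> fixes g (pt_of v) = (v *m gmx g <= v)%MS.
Proof.
move=> nz_v; have E := pt_of_eqmx nz_v; rewrite /fixes (eqmxMr _ E).
by rewrite E.
Qed.

Lemma mul_gmx_neq0 (v : 'rV[F]_2) g : v != 0 -> v *m gmx g != 0.
Proof.
by apply: contra_neq => vg0; rewrite -(mulmxK (gmx_unit g) v) vg0 mul0mx.
Qed.

Lemma gmx_submx (v w : 'rV[F]_2) g : (v *m gmx g <= w *m gmx g)%MS = (v <= w)%MS.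
Proof. by rewrite submxMfree // row_free_unit gmx_unit. Qed.

Lemma nfixJ g y : nfix (g ^ y)%g = nfix g.
Proof.
suff le_fix h z : (nfix h <= nfix (h ^ z)%g)%N.
  by apply/eqP; rewrite eqn_leq le_fix andbT -{2}[g](conjgK y) le_fix.
pose move_pt p := pt_of (pt_vec p *m gmx z).
have nz p : pt_vec p *m gmx z != 0 by rewrite mul_gmx_neq0 ?pt_vec_neq0.
have inj_move : injective move_pt.
  move=> p p' E; apply: pt_vec_inj; rewrite -(gmx_submx _ _ z).
  by rewrite -(pt_of_eqmx (nz p)) -(pt_of_eqmx (nz p')) -/(move_pt p) E.
rewrite /nfix -(card_imset (fixpts h) inj_move).
apply/subset_leq_card/subsetP=> _ /imsetP[p fp ->].
move: fp; rewrite !inE /move_pt fixes_pt_of // /fixes.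
by rewrite -mulmxA -gmxM -conjgC gmxM mulmxA gmx_submx.
Qed.

Lemma fixesZ z g p : z \in 'Z('GL_2[F])%g -> fixes (z * g)%g p = fixes g p.
Proof.
case/GL2_centerP=> a; rewrite -[GLval z]/(gmx z) => za.
have nz_a : a != 0.
  apply: contraTneq (gmx_unit z) => a0.
  by rewrite za a0 unitmxE det_scalar expr2 mul0r unitr0.
by rewrite /fixes gmxM za mul_scalar_mx -scalemxAr; rewrite (eqmx_scale _ nz_a).
Qed.

Lemma nfixZ z g : z \in 'Z('GL_2[F])%g -> nfix (z * g)%g = nfix g.
Proof. by move=> Zz; apply: eq_card => p; rewrite !inE fixesZ. Qed.

Definition pt_line p : {set 'rV[F]_2} := [set a *: pt_vec p | a : F].

Lemma mem_pt_line p v : (v \in pt_line p) = (v <= pt_vec p)%MS.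
Proof.
by apply/imsetP/sub_rVP=> [[a _ ->] | [a ->]]; exists a.
Qed.

Lemma proj_lineE : proj_line F = [set pt_line p | p : option F].
Proof.
apply/setP=> L; apply/imsetP/imsetP=> [[v] | [p _ ->]].
  rewrite inE => nz_v ->; exists (pt_of v) => //; apply/setP=> w.
  rewrite mem_pt_line pt_of_eqmx //.
  by apply/imsetP/sub_rVP=> [[a _ ->] | [a ->]]; exists a.
by exists (pt_vec p) => //; rewrite inE pt_vec_neq0.
Qed.

Lemma pt_line_inj : injective pt_line.
Proof.
by move=> p p' E; apply: pt_vec_inj; rewrite -mem_pt_line -E mem_pt_line.
Qed.

Lemma card_proj_fix g : #|proj_fix (coset 'Z('GL_2[F]) g)| = nfix g.
Proof.
rewrite /nfix -(card_imset _ pt_line_inj) proj_fixE; apply: eq_card => L.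
rewrite inE proj_lineE; apply/andP/imsetP=> [[/imsetP[p _ ->] fix_p] | [p fp ->]].
  exists p => //; rewrite inE /fixes -mem_pt_line -(eqP fix_p).
  by apply: imset_f; rewrite mem_pt_line.
split; first exact: imset_f.
have eqV : (pt_vec p *m gmx g :=: pt_vec p)%MS.
  apply/eqmxP; rewrite -mxrank_leqif_eq; last by move: fp; rewrite inE.
  by rewrite mxrankMfree ?row_free_unit ?gmx_unit.
apply/eqP/setP=> v; rewrite mem_pt_line -eqV.
apply/imsetP/submxP=> [[w Lw ->] | [D ->]].
  by move: Lw; rewrite mem_pt_line => /submxP[D ->]; exists D; rewrite mulmxA.
by exists (D *m pt_vec p); rewrite ?mulmxA // mem_pt_line submxMl.
Qed.

End Points.

(** * The Borel subgroup and the split torus *)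

Section Borel.
Variable F : finFieldType.
Implicit Types (a b c d x : F) (g h y z : {'GL_2[F]}) (p : option F).
Local Notation q := #|F|.
Local Notation Z := 'Z('GL_2[F])%g.

Lemma q_gt1 : (1 < q)%N. Proof. exact: finNzRing_gt1. Qed.

Definition lowmx a x c := gl2 a 0 x c.

Arguments lowmx (a x c)%_R.

Lemma lowmxE a x c : a != 0 -> c != 0 -> gmx (lowmx a x c) = mx2 a 0 x c.
Proof. by move=> a0 c0; rewrite gl2K // mul0r subr0 mulf_neq0. Qed.

Lemma lowmxM a x c a' x' c' : a != 0 -> c != 0 -> a' != 0 -> c' != 0 ->
  (lowmx a x c * lowmx a' x' c')%g = lowmx (a * a') (x * a' + c * x') (c * c').
Proof.
move=> a0 c0 a0' c0'; apply: gmx_inj.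
rewrite gmxM !lowmxE ?mulf_neq0 // mulmx2.
by rewrite !(mulr0, mul0r) !(addr0, add0r).
Qed.

Lemma lowmx1 : lowmx 1 0 1 = 1%g.
Proof. by apply: gmx_inj; rewrite lowmxE ?oner_eq0 // gmx1 scalar_mx2. Qed.

Lemma borel_diag g : g \in borel F -> gmx g 0 0 != 0 /\ gmx g 1 1 != 0.
Proof.
rewrite inE => /eqP b0; have := GL_det_neq0 g.
by rewrite b0 mul0r subr0 mulf_eq0 negb_or => /andP[].
Qed.

Lemma borelE g : g \in borel F -> g = lowmx (gmx g 0 0) (gmx g 1 0) (gmx g 1 1).
Proof. by rewrite inE => /eqP b0; rewrite {1}[g]gl2E b0. Qed.

(** If a or c is 0, the matrix is not invertible and gl2 returns 1. *)
Lemma lowmx_borel a x c : lowmx a x c \in borel F.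
Proof.
have [/andP[a0 c0] | ] := boolP ((a != 0) && (c != 0)).
  by rewrite inE lowmxE // mx2_entries.
rewrite negb_and !negbK => ac0; suff -> : lowmx a x c = 1%g.
  by rewrite inE gmx1 mxE.
rewrite /lowmx /gl2; case: insubP => //= u.
rewrite -[_ \is a _]/(_ \in unitmx) unitmxE det_mx2 unitfE mul0r subr0.
by rewrite mulf_eq0 ac0.
Qed.

Lemma sum_borel_param (phi : {'GL_2[F]} -> algC) :
  \sum_(g in borel F) phi g =
  \sum_(a | a != 0) \sum_(c | c != 0) \sum_x phi (lowmx a x c).
Proof.
pose h (p : F * (F * F)) := lowmx p.1 p.2.2 p.2.1.
pose h' g := (gmx g 0 0, (gmx g 1 1, gmx g 1 0)).
transitivity (\sum_(p : F * (F * F) | (p.1 != 0) && (p.2.1 != 0)) phi (h p)).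
  rewrite (reindex_onto h h') => [|g Bg]; last by rewrite /h /h' -borelE.
  apply: eq_bigl => -[a [c x]]; rewrite /h /h' lowmx_borel /=.
  apply/eqP/andP=> [| [a0 c0]]; last by rewrite !lowmxE // !mx2_entries.
  by case=> A C _; have := borel_diag (lowmx_borel a x c); rewrite A C.
under [RHS]eq_bigr => a _ do rewrite pair_big_dep /=.
by rewrite pair_big_dep /=; apply: eq_bigl => -[a [c x]]; rewrite /= andbT.
Qed.

Lemma lowmx_conj_diag a x c : a != 0 -> c != 0 -> a != c ->
  exists y, lowmx a x c = (lowmx a 0 c ^ y)%g.
Proof.
move=> a0 c0 ac; pose v := lowmx 1 (x / (c - a))%R 1; exists v.
apply: (mulgI v); rewrite /conjg mulKVg /v !lowmxM ?oner_eq0 //.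
congr (lowmx _ _ _); rewrite ?mulr1 ?mul1r //.
by field; rewrite subr_eq0 eq_sym.
Qed.

Lemma scal_Z a : a != 0 -> lowmx a 0 a \in Z.
Proof. by move=> a0; rewrite Z_entriesP lowmxE // !mx2_entries !eqxx. Qed.

(** So lowmx 1 1 1 represents, up to conjugacy and the center, all elements with
    exactly one fixed point. *)
Lemma lowmx_conj_unip a x : a != 0 -> x != 0 ->
  exists y, lowmx a x a = ((lowmx a 0 a * lowmx 1 1 1) ^ y)%g.
Proof.
move=> a0 x0; have n1 := oner_neq0 F.
have xa0 : (x / a)%R != 0 by rewrite mulf_neq0 ?invr_eq0.
pose v := lowmx (x / a)%R 0 1; exists v.
apply: (mulgI v); rewrite /conjg mulKVg /v !lowmxM ?mulr1 //.
congr (lowmx _ _ _); [ring | by field | ring].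
Qed.

Section Sums.
Variable phi : {'GL_2[F]} -> algC.
Hypothesis phiJ : forall g y, phi (g ^ y)%g = phi g.
Hypothesis phiZ : forall z g, z \in Z -> phi (z * g)%g = phi g.

(** Count the pairs (g, p) with g fixing p: all stabilizers are conjugate to
    borel. In character terms nfix is the character induced from the principal
    character of borel. *)
Lemma sum_nfix :
  \sum_g phi g * (nfix g)%:R = q.+1%:R * \sum_(g in borel F) phi g.
Proof.
transitivity (\sum_g \sum_p phi g * (fixes g p)%:R).
  apply: eq_bigr => g _; rewrite -mulr_sumr; congr (_ * _).
  rewrite /nfix -sum1_card natr_sum big_mkcond /=.
  by apply: eq_bigr => p _; rewrite inE; case: fixes.
rewrite exchange_big /= (eq_bigr (fun=> \sum_(g in borel F) phi g)).
  by rewrite sumr_const card_option mulr_natl.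
move=> p _; rewrite (reindex_inj (conjg_inj (pt_rep p))) /=.
rewrite [RHS]big_mkcond /=; apply: eq_bigr => g _.
by rewrite fixes_borel conjgK phiJ; case: ifP; rewrite ?mulr1 ?mulr0.
Qed.

Lemma phi_lowmx_neq a x c : a != 0 -> c != 0 -> a != c ->
  phi (lowmx a x c) = phi (lowmx a 0 c).
Proof. by move=> a0 c0 ac; have [y ->] := lowmx_conj_diag x a0 c0 ac. Qed.

Lemma phi_lowmx_eq a x : a != 0 ->
  phi (lowmx a x a) = if x == 0 then phi 1%g else phi (lowmx 1 1 1).
Proof.
move=> a0; case: eqP => [-> | /eqP x0].
  by rewrite -[lowmx a 0 a]mulg1 phiZ ?scal_Z.
by have [y ->] := lowmx_conj_unip a0 x0; rewrite phiJ phiZ ?scal_Z.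
Qed.

Definition diag_sum (f : {'GL_2[F]} -> algC) :=
  \sum_(a : F | a != 0) \sum_(c : F | (c != 0) && (c != a)) f (lowmx a 0 c).

Lemma card_neq0 : #|[pred a : F | a != 0]| = q.-1.
Proof. by rewrite -(cardC1 (0 : F)); apply: eq_card. Qed.

(** A triangular matrix with distinct eigenvalues is conjugate to its diagonal,
    and one with a double eigenvalue is central or central times a unipotent. *)
Lemma sum_borel : \sum_(g in borel F) phi g =
  q%:R * diag_sum phi + q.-1%:R * phi 1%g
  + q.-1%:R ^+ 2 * phi (lowmx 1 1 1).
Proof.
rewrite sum_borel_param.
transitivity (\sum_(a : F | a != 0) (phi 1%g + q.-1%:R * phi (lowmx 1 1 1) +
   q%:R * \sum_(c : F | (c != 0) && (c != a)) phi (lowmx a 0 c))).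
  apply: eq_bigr => a a0; rewrite (bigD1 a) //=; congr (_ + _).
    rewrite (bigD1 0) //= phi_lowmx_eq // eqxx; congr (_ + _).
    rewrite (eq_bigr (fun=> phi (lowmx 1 1 1))) => [|x x0]; last first.
      by rewrite phi_lowmx_eq // (negPf x0).
    by rewrite sumr_const card_neq0 mulr_natl.
  rewrite mulr_sumr; apply: eq_bigr => c /andP[c0 ca].
  rewrite (eq_bigr (fun=> phi (lowmx a 0 c))) => [|x _]; last first.
    by rewrite phi_lowmx_neq // eq_sym.
  by rewrite sumr_const mulr_natl.
rewrite big_split /= -mulr_sumr sumr_const card_neq0 -[X in X + _]mulr_natl.
by rewrite /diag_sum; ring.
Qed.

Definition torus := [set g : {'GL_2[F]} | (gmx g 0 1 == 0) && (gmx g 1 0 == 0)].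

Lemma sum_torus : \sum_(g in torus) phi g = diag_sum phi + q.-1%:R * phi 1%g.
Proof.
pose w g : algC := (gmx g 1 0 == 0)%:R.
transitivity (\sum_(g in borel F) w g * phi g).
  rewrite big_mkcond [RHS]big_mkcond /=; apply: eq_bigr => g _.
  by rewrite !inE /w; case: (_ 0 1 == 0); case: (_ == 0); rewrite ?mul1r ?mul0r.
rewrite sum_borel_param.
transitivity (\sum_(a : F | a != 0) (phi 1%g +
   \sum_(c : F | (c != 0) && (c != a)) phi (lowmx a 0 c))); last first.
  by rewrite big_split /= sumr_const card_neq0 mulr_natl addrC.
have sumx a c : a != 0 -> c != 0 ->
    \sum_x w (lowmx a x c) * phi (lowmx a x c) = phi (lowmx a 0 c).
  move=> a0 c0; rewrite (bigD1 0) //= big1 ?addr0 => [|x x0].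
    by rewrite /w lowmxE // mx2_entries eqxx mul1r.
  by rewrite /w lowmxE // mx2_entries (negPf x0) mul0r.
apply: eq_bigr => a a0; rewrite (bigD1 a) //= sumx // phi_lowmx_eq // eqxx.
by congr (_ + _); apply: eq_bigr => c /andP[c0 _]; rewrite sumx.
Qed.

End Sums.

Lemma nfix_diag a c : a != 0 -> c != 0 -> a != c -> nfix (lowmx a 0 c) = 2.
Proof.
move=> a0 c0 ac; rewrite /nfix.
have -> : fixpts (lowmx a 0 c) = [set None; Some 0].
  apply/setP=> -[x|]; rewrite !inE ?fixes_None ?fixes_Some lowmxE //= !mx2_entries.
    rewrite mulr0 add0r addr0 -[Some x == _]/(x == 0) -subr_eq0 -mulrBr mulf_eq0.
    by rewrite subr_eq0 [c == a]eq_sym (negPf ac) orbF.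
  exact: eqxx.
by rewrite cards2.
Qed.

Lemma nfix_unip : nfix (lowmx 1 1 1) = 1.
Proof.
rewrite /nfix (_ : fixpts _ = [set None]) ?cards1 //.
apply/setP=> -[x|]; rewrite !inE ?fixes_None ?fixes_Some lowmxE ?oner_eq0 //=
  !mx2_entries ?eqxx //.
by rewrite mulr0 add0r -subr_eq0 opprD addrA subrr add0r oppr_eq0 oner_eq0.
Qed.

Lemma nfix1 : nfix (1 : {'GL_2[F]})%g = q.+1.
Proof.
rewrite /nfix (_ : fixpts _ = setT) ?cardsT ?card_option //.
by apply/setP=> p; rewrite !inE /fixes gmx1 mulmx1 submx_refl.
Qed.

Lemma sum_const_borel : \sum_(g in borel F) 1 = q%:R * q.-1%:R ^+ 2 :> algC.
Proof.
rewrite (sum_borel_param (fun=> 1)).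
under eq_bigr => a _ do under eq_bigr => c _ do rewrite sumr_const.
under eq_bigr => a _ do rewrite sumr_const card_neq0.
by rewrite sumr_const card_neq0 -!mulrnA -natrX -natrM expnS expn1 mulnA.
Qed.

(** An element with a fixed point is conjugate into borel, where lowmx_conj_diag
    and lowmx_conj_unip apply. *)
Lemma nfix_conj_cases g :
  [\/ exists y, (g ^ y)%g \in torus,
      exists y, exists2 z, z \in Z & (g ^ y = z * lowmx 1 1 1)%g
    | nfix g = 0].
Proof.
case: (set_0Vmem (fixpts g)) => [f0 | [p]].
  by constructor 3; rewrite /nfix f0 cards0.
rewrite inE fixes_borel => Bg; have [] := borel_diag Bg; have := borelE Bg.
set h := (g ^ _)%g in Bg *; move: (gmx h 0 0) (gmx h 1 0) (gmx h 1 1) => a x c E a0 c0.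
have [ac | ac] := eqVneq a c; last first.
  constructor 1; have [y Ey] := lowmx_conj_diag x a0 c0 ac.
  exists ((pt_rep p)^-1 * y^-1)%g; rewrite conjgM -/h E Ey conjgK.
  by rewrite inE lowmxE // !mx2_entries !eqxx.
rewrite -{c}ac in E c0; have [x0 | x0] := eqVneq x 0.
  constructor 1; exists (pt_rep p)^-1%g.
  by rewrite -/h E x0 inE lowmxE // !mx2_entries !eqxx.
constructor 2; have [y Ey] := lowmx_conj_unip a0 x0.
exists ((pt_rep p)^-1 * y^-1)%g; exists (lowmx a 0 a); first exact: scal_Z.
by rewrite conjgM -/h E Ey conjgK.
Qed.

Lemma torusE g : g \in torus -> exists a c, [/\ a != 0, c != 0 & g = lowmx a 0 c].
Proof.
rewrite inE => /andP[b0 c0]; have Bg : g \in borel F by rewrite inE.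
have [a d] := borel_diag Bg; exists (gmx g 0 0), (gmx g 1 1); split=> //.
by rewrite {1}(borelE Bg) (eqP c0).
Qed.

Lemma nfix_center z : z \in Z -> nfix z = q.+1.
Proof. by move=> Zz; rewrite -[z]mulg1 nfixZ // nfix1. Qed.

Lemma center_conj g y : ((g ^ y)%g \in Z) = (g \in Z).
Proof.
rewrite -[RHS](memJ_conjg _ y) (normP _) //.
by apply: (subsetP (normal_norm (center_normal _))); rewrite inE.
Qed.

Lemma nfix_noncentral g : g \notin Z -> (nfix g <= 2)%N.
Proof.
move=> nZg; case: (nfix_conj_cases g) => [[y Ty] | [y [z Zz E]] | -> //].
  have [a [c [a0 c0 E]]] := torusE Ty; rewrite -(nfixJ g y) E.
  have [ac | ac] := eqVneq a c; last by rewrite nfix_diag.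
  by case/negP: nZg; rewrite -(center_conj g y) E -ac scal_Z.
by rewrite -(nfixJ g y) E nfixZ // nfix_unip.
Qed.

End Borel.

Arguments lowmx {F} (a x c)%_R.

(** * Elliptic elements and nonsplit tori *)

Section Elliptic.
Variable F : finFieldType.
Implicit Types (a b c d x : F) (A X Y : 'M[F]_2) (g h y z : {'GL_2[F]}).
Local Notation q := #|F|.
Local Notation Z := 'Z('GL_2[F])%g.

Lemma card_Z : #|Z| = q.-1.
Proof.
rewrite -(card_neq0 F) -(card_in_imset (f := fun a : F => lowmx a 0 a)).
  apply: eq_card => z; apply/idP/imsetP=> [Zz | [a]]; last first.
    by rewrite inE => a0 ->; apply: scal_Z.
  have:= Zz; rewrite Z_entriesP => /and3P[b0 /eqP c0 /eqP ad].
  have Bz : z \in borel F by rewrite inE.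
  exists (gmx z 0 0); first by have [] := borel_diag Bz.
  by rewrite {1}(borelE Bz) c0 ad.
move=> a c; rewrite !inE => a0 c0 /(congr1 (fun g => gmx g 0 0)).
by rewrite !lowmxE // !mx2_entries.
Qed.

Lemma elliptic_line g (v : 'rV[F]_2) : nfix g = 0 -> v != 0 ->
  ~~ (v *m gmx g <= v)%MS.
Proof.
move=> f0 nz_v; rewrite -fixes_pt_of //; apply/negP=> fv.
by have := cards0_eq f0 => /setP/(_ (pt_of v)); rewrite !inE fv.
Qed.

(** The kernel of a nonzero singular Y that commutes with g would be a line
    stable under g. Hence the commutant of an elliptic g is a field. *)
Lemma elliptic_comm_unit g Y : nfix g = 0 -> Y *m gmx g = gmx g *m Y ->
  Y != 0 -> Y \in unitmx.
Proof.
move=> f0 cY nzY; rewrite unitmxE unitfE; apply/negP=> /det0P[v nz_v vY].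
have rY : (0 < \rank Y)%N by rewrite lt0n mxrank_eq0.
have sv : (v <= kermx Y)%MS by apply/sub_kermxP.
have rk : \rank (kermx Y) = 1.
  apply/eqP; rewrite eqn_leq; apply/andP; split.
    by rewrite mxrank_ker leq_subLR addn1 ltnS.
  by have := mxrankS sv; rewrite rank_rV nz_v.
have eqv : (v :=: kermx Y)%MS.
  by apply/eqmxP; rewrite -(mxrank_leqif_eq sv) rk rank_rV nz_v.
case/negP: (elliptic_line f0 nz_v); rewrite eqv; apply/sub_kermxP.
by rewrite -mulmxA -cY mulmxA vY mul0mx.
Qed.

Lemma elliptic_comm_row0 g Y : nfix g = 0 -> Y *m gmx g = gmx g *m Y ->
  Y 0 0 = 0 -> Y 0 1 = 0 -> Y = 0.
Proof.
move=> f0 cY Y00 Y01; apply/eqP/negPn/negP=> /(elliptic_comm_unit f0 cY).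
by rewrite unitmxE [Y]mx2E det_mx2 Y00 Y01 !mul0r subr0 unitr0.
Qed.

Lemma elliptic_b g : nfix g = 0 -> gmx g 0 1 != 0.
Proof.
move=> f0; rewrite -fixes_None; apply/negP=> fv.
by have := cards0_eq f0 => /setP/(_ None); rewrite !inE fv.
Qed.

(** The element of F[g] whose first row is (s, t); it exists because (1, 0) and its
    image under an elliptic g form a basis. *)
Definition row0_mx g (s t : F) : 'M[F]_2 :=
  (s - t / gmx g 0 1 * gmx g 0 0)%:M + (t / gmx g 0 1) *: gmx g.

Lemma row0_mxE g s t : gmx g 0 1 != 0 ->
  (row0_mx g s t 0 0 = s) * (row0_mx g s t 0 1 = t).
Proof.
move=> b0; rewrite /row0_mx; split; rewrite !mxE /=.
  by rewrite mulr1n subrK.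
by rewrite mulr0n add0r divfK.
Qed.

Lemma row0_mx_comm g s t : row0_mx g s t *m gmx g = gmx g *m row0_mx g s t.
Proof.
by rewrite /row0_mx mulmxDl mulmxDr scalar_mxC -scalemxAl -scalemxAr.
Qed.

Lemma elliptic_commE g Y : nfix g = 0 -> Y *m gmx g = gmx g *m Y ->
  Y = row0_mx g (Y 0 0) (Y 0 1).
Proof.
move=> f0 cY; apply/eqP; rewrite -subr_eq0; apply/eqP.
have b0 := elliptic_b f0.
apply: (elliptic_comm_row0 f0).
- by rewrite mulmxBl mulmxBr cY row0_mx_comm.
- by rewrite mxE [X in _ + X]mxE row0_mxE // subrr.
by rewrite mxE [X in _ + X]mxE row0_mxE // subrr.
Qed.

Lemma elliptic_comm_comm g X Y : nfix g = 0 ->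
  X *m gmx g = gmx g *m X -> Y *m gmx g = gmx g *m Y -> X *m Y = Y *m X.
Proof.
move=> f0 cX cY; rewrite (elliptic_commE f0 cX).
by rewrite mulmxDl mulmxDr scalar_mxC -scalemxAl -scalemxAr cY.
Qed.

Lemma cent1_gmx g h : (h \in 'C[g])%g = (gmx h *m gmx g == gmx g *m gmx h).
Proof.
apply/cent1P/eqP => [E | E]; first by rewrite -!gmxM E.
by apply: gmx_inj; rewrite !gmxM E.
Qed.

Lemma card_elliptic_cent g : nfix g = 0 -> #|'C[g]%g| = (q ^ 2 - 1)%N.
Proof.
move=> f0; have b0 := elliptic_b f0.
pose k h := (gmx h 0 0, gmx h 0 1).
rewrite -(card_in_imset (f := k)) => [|h h']; last first.
  rewrite !cent1_gmx => /eqP ch /eqP ch' [E0 E1]; apply: gmx_inj.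
  by rewrite (elliptic_commE f0 ch) (elliptic_commE f0 ch') E0 E1.
have -> : k @: 'C[g]%g = [set~ (0, 0)].
  apply/setP=> -[s t]; rewrite !inE; apply/imsetP/idP=> [[h ch ->] | nz].
    apply/eqP=> -[h0 h1]; have := GL_det_neq0 h.
    by rewrite h0 h1 !mul0r subrr eqxx.
  pose Y := row0_mx g s t; have [Y0 Y1] := row0_mxE s t b0.
  have UY : Y \in unitmx.
    apply: (elliptic_comm_unit f0 (row0_mx_comm g s t)).
    apply: contraNneq nz => Y00; move: Y0 Y1.
    by rewrite Y00 !mxE => <- <-.
  pose h := gl2 (Y 0 0) (Y 0 1) (Y 1 0) (Y 1 1).
  have hY : gmx h = Y.
    by rewrite gl2K -?mx2E // -det_mx2 -mx2E -unitfE -unitmxE.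
  exists h; first by rewrite cent1_gmx hY row0_mx_comm.
  by rewrite /k hY Y0 Y1.
by rewrite cardsC1 card_prod -mulnn subn1.
Qed.

Lemma cayley2 X : X *m X = \tr X *: X - (\det X)%:M.
Proof.
rewrite {1 2 4 5}[X]mx2E mulmx2 det_mx2 /mxtrace sum_ord2.
apply/matrixP=> i j; rewrite !mxE.
by case: (ord2P i) => ->; case: (ord2P j) => ->; rewrite /= ?mulr1n ?mulr0n; ring.
Qed.

(** X and Y lie in the field that commutes with g and have the same characteristic
    polynomial, whose roots there are X and tr X - X. *)
Lemma elliptic_roots g X Y : nfix g = 0 ->
    X *m gmx g = gmx g *m X -> Y *m gmx g = gmx g *m Y ->
    \tr X = \tr Y -> \det X = \det Y ->
  Y = X \/ Y = (\tr X)%:M - X.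
Proof.
move=> f0 cX cY eqT eqD; have [|nz] := eqVneq Y X; first by left.
(* (Y - X) (Y + X - tr X) = 0 by Cayley-Hamilton, and Y - X is invertible. *)
right; apply/eqP; rewrite -subr_eq0; apply/eqP.
have cXY := elliptic_comm_comm f0 cX cY.
have U : Y - X \in unitmx.
  by apply: (elliptic_comm_unit f0); rewrite ?subr_eq0 // mulmxBl mulmxBr cX cY.
rewrite -(mulKmx U (Y - _)) (_ : (Y - X) *m _ = 0) ?mulmx0 //.
rewrite opprB mulmxBl !mulmxDr !mulmxN !mul_mx_scalar !cayley2 -eqT -eqD cXY.
by apply/matrixP=> i j; rewrite !mxE; ring.
Qed.

End Elliptic.

Section Count.
Variable F : finFieldType.
Implicit Types (a b c d : F) (g h x y z : {'GL_2[F]}).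
Local Notation q := #|F|.
Local Notation G := 'GL_2[F].
Local Notation Z := 'Z('GL_2[F])%g.

Lemma q_pred : q.-1%:R = q%:R - 1 :> algC.
Proof. by rewrite -subn1 natrB // ltnW ?q_gt1. Qed.

Lemma q_succ : q.+1%:R = q%:R + 1 :> algC.
Proof. by rewrite -addn1 natrD. Qed.

Lemma card_GL_C : #|G|%:R = q%:R * (q%:R - 1) ^+ 2 * (q%:R + 1) :> algC.
Proof. by rewrite card_GL_2 -mulnn !natrM q_pred q_succ expr2. Qed.

Lemma Z_sub_cent1 g : Z \subset 'C[g]%g.
Proof.
by apply/subsetP=> z /centerP[_ cz]; apply/cent1P; apply: cz; rewrite inE.
Qed.

Definition elliptics := [set g : {'GL_2[F]} | nfix g == 0].

Section Sums.
Variable phi : {'GL_2[F]} -> algC.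
Hypothesis phiJ : forall g y, phi (g ^ y)%g = phi g.
Hypothesis phiZ : forall z g, z \in Z -> phi (z * g)%g = phi g.

Lemma q_sum_torus : q%:R * \sum_(g in torus F) phi g =
  \sum_(g in borel F) phi g + (q%:R - 1) ^+ 2 * (phi 1%g - phi (lowmx 1 1 1)).
Proof. by rewrite sum_torus // sum_borel // q_pred; ring. Qed.

(** On borel, nfix - 1 counts the fixed points other than None: it is 1 at the
    elements with distinct eigenvalues, 0 at the central multiples of nontrivial
    unipotents, and q on the center. So sum_nfix, applied to phi * (nfix - 1),
    leaves q times the sum over the torus. In character terms nfix * (nfix - 1) is
    induced from the principal character of the torus. *)
Lemma sum_nfix2 :
  \sum_g phi g * ((nfix g)%:R * ((nfix g)%:R - 1)) =
  (q%:R + 1) * q%:R * \sum_(g in torus F) phi g.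
Proof.
pose phi' g := phi g * ((nfix g)%:R - 1).
have phi'J g y : phi' (g ^ y)%g = phi' g by rewrite /phi' phiJ nfixJ.
have phi'Z z g : z \in Z -> phi' (z * g)%g = phi' g.
  by move=> Zz; rewrite /phi' phiZ // nfixZ.
transitivity (\sum_g phi' g * (nfix g)%:R).
  by apply: eq_bigr => g _; rewrite /phi'; ring.
rewrite sum_nfix // sum_borel // sum_torus // q_succ q_pred.
have -> : diag_sum phi' = diag_sum phi.
  apply: eq_bigr => a a0; apply: eq_bigr => c /andP[c0 ca].
  by rewrite /phi' nfix_diag // 1?eq_sym //; ring.
by rewrite /phi' nfix_unip nfix1 q_succ; ring.
Qed.

(** The polynomial (f - 1) (f - 2) vanishes at f = 1 and f = 2, the numbers of
    points fixed by the noncentral elements that are not elliptic. *)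
Lemma sum_elliptics :
  \sum_g phi g * (((nfix g)%:R - 1) * ((nfix g)%:R - 2)) =
  2 * \sum_(g in elliptics) phi g + (q%:R * (q%:R - 1)) * \sum_(g in Z) phi g.
Proof.
rewrite !mulr_sumr [X in _ = X + _]big_mkcond [X in _ = _ + X]big_mkcond -big_split /=.
apply: eq_bigr => g _; rewrite inE; have [Zg | Zg] := boolP (g \in Z); last first.
  have := nfix_noncentral Zg; rewrite addr0.
  by case: (nfix g) => [|[|[|]]] //= _; ring.
by rewrite nfix_center //= q_succ; ring.
Qed.

End Sums.

(** Evaluate sum_elliptics at the constant function 1. *)
Lemma card_elliptics : (2 * #|elliptics| = (q * q.-1) ^ 2)%N.
Proof.
apply/eqP; rewrite -(eqr_nat algC); apply/eqP.
have sumE := @sum_elliptics (fun=> 1).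
have s0 : \sum_(g : {'GL_2[F]}) 1 = #|G|%:R :> algC.
  by rewrite sumr_const cardsT.
have s1 := @sum_nfix F (fun=> 1) (fun _ _ => erefl).
have s2 := @sum_nfix2 (fun=> 1) (fun _ _ => erefl) (fun _ _ _ => erefl).
have s3 := @q_sum_torus (fun=> 1) (fun _ _ => erefl) (fun _ _ _ => erefl).
rewrite sum_const_borel q_pred subrr mulr0 addr0 in s3.
rewrite sum_const_borel q_pred q_succ in s1.
rewrite -mulrA s3 in s2.
have : \sum_(g : {'GL_2[F]}) 1 * (((nfix g)%:R - 1) * ((nfix g)%:R - 2)) =
   (\sum_(g : {'GL_2[F]}) 1 * ((nfix g)%:R * ((nfix g)%:R - 1)) +
   (- 2) * \sum_(g : {'GL_2[F]}) 1 * (nfix g)%:R) + 2 * \sum_(g : {'GL_2[F]}) 1 :> algC.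
  by rewrite !mulr_sumr -!big_split /=; apply: eq_bigr => g _; ring.
rewrite s0 s1 s2 sumE !sumr_const card_Z card_GL_C q_pred natrM natrX natrM q_pred.
by move/(canRL (addrK _)) => ->; ring.
Qed.

Lemma elliptic_exists : exists g, nfix g = 0.
Proof.
have /card_gt0P[g] : (0 < #|elliptics|)%N.
  have: (0 < 2 * #|elliptics|)%N; last by rewrite muln_gt0.
  have q1 := q_gt1 F; rewrite card_elliptics expn_gt0 muln_gt0.
  by rewrite (ltnW q1) -subn1 subn_gt0 q1.
by rewrite inE => /eqP; exists g.
Qed.

(** If g fixed a line, with eigenvalue a, then g - a would be singular and commute
    with x, hence be 0. *)
Lemma ell_comm g x : nfix x = 0 -> g \in 'C[x]%g -> g \notin Z -> nfix g = 0.
Proof.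
move=> fx; rewrite cent1_gmx => /eqP cgx; apply: contraNeq => fg.
have /card_gt0P[p] : (0 < #|fixpts g|)%N by rewrite lt0n.
rewrite inE => /sub_rVP[a pa]; apply/GL2_centerP; exists a.
apply/eqP; rewrite -[GLval g]/(gmx g) -subr_eq0; apply/negPn/negP => nz.
have : gmx g - a%:M \in unitmx.
  by apply: (elliptic_comm_unit fx); rewrite // mulmxBl mulmxBr cgx scalar_mxC.
move/mulmxK => K1; have := K1 _ (pt_vec p).
rewrite mulmxBr pa mul_mx_scalar subrr mul0mx => /esym/eqP.
by rewrite (negPf (pt_vec_neq0 p)).
Qed.

Lemma ell_cent_noncentral x : nfix x = 0 ->
  [set g in elliptics | g \in 'C[x]%g] = 'C[x]%g :\: Z.
Proof.
move=> fx; apply/setP=> g; rewrite in_set in_setD in_set andbC [RHS]andbC.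
case cg: (g \in 'C[x]%g) => //=.
apply/eqP/idP=> [fg | nZg]; last exact: (ell_comm fx).
by apply/negP=> /nfix_center; rewrite fg.
Qed.

Lemma card_ell_cent_noncentral x : nfix x = 0 ->
  #|'C[x]%g :\: Z| = (q * q.-1)%N.
Proof.
move=> fx; rewrite cardsD (setIidPr (Z_sub_cent1 x)) card_Z card_elliptic_cent //.
have := q_gt1 F; case: q => // [[|n]] // _ /=; lia.
Qed.

Lemma elliptic_cent_abelian (g0 : {'GL_2[F]}) : nfix g0 = 0 -> abelian 'C[g0]%g.
Proof.
move=> f0; apply/centsP=> g; rewrite cent1_gmx => /eqP cg h; rewrite cent1_gmx => /eqP ch.
by apply: gmx_inj; rewrite !gmxM (elliptic_comm_comm f0 cg ch).
Qed.

(** A finite subgroup of the multiplicative group of a field is cyclic. *)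
Lemma elliptic_cent_cyclic (g0 : {'GL_2[F]}) : nfix g0 = 0 -> cyclic 'C[g0]%g.
Proof.
pose M2 : unitRingType := 'M[F]_2 => f0.
apply: (@div_ring_mul_group_cyclic _ 'C[g0]%G M2 (@gmx F)) => //.
- move=> x /setD1P[x1 cx]; apply: (elliptic_comm_unit f0).
    by move: cx; rewrite cent1_gmx mulmxBl mulmxBr mul1mx mulmx1 => /eqP->.
  by rewrite subr_eq0; apply: contra_neq x1 => E; apply: gmx_inj.
exact: elliptic_cent_abelian.
Qed.

Lemma card_elliptic_cent_C (g0 : {'GL_2[F]}) : nfix g0 = 0 ->
  #|'C[g0]%g|%:R = (q%:R + 1) * (q%:R - 1) :> algC.
Proof.
move=> f0; rewrite card_elliptic_cent // natrB ?natrX; last first.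
  by rewrite expn_gt0 ltnW ?q_gt1.
by ring.
Qed.

Section NonsplitTorus.
Variable g0 : {'GL_2[F]}.
Hypothesis ell0 : nfix g0 = 0.
Let K := (g0 ^: G)%g.

Lemma ell_class x : x \in K -> nfix x = 0.
Proof. by case/imsetP=> y _ ->; rewrite nfixJ. Qed.

Lemma card_ell_class : #|K| = (q * q.-1)%N.
Proof.
have E : (#|'C_G[g0]%g| * #|K| = #|G|)%N by rewrite -index_cent1 Lagrange ?subsetIl.
have q1 := q_gt1 F; have := card_elliptic_cent ell0.
have cE : 'C_G[g0]%g = 'C[g0]%g by apply/setIidPr/subsetP=> h _; rewrite inE.
move=> c0; rewrite cE c0 card_GL_2 in E.
have q2 : (0 < q ^ 2 - 1)%N by rewrite subn_gt0 (ltn_trans q1) // ltn_Pmull // ltnW.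
apply/eqP; rewrite -(eqn_pmul2l q2) E; apply/eqP.
move: q1; case: q => // [[|n]] // _ /=; lia.
Qed.

(** The value at g of the character induced from the principal character of
    'C[g0]. *)
Definition ncomm g := #|[set x in K | g \in 'C[x]%g]|.

Lemma class_tr_det x : x \in K ->
  \tr (gmx x) = \tr (gmx g0) /\ \det (gmx x) = \det (gmx g0).
Proof.
case/imsetP=> y _ ->; rewrite conjgE gmxM gmxM; split.
  by rewrite mxtrace_mulC -mulmxA -gmxM mulgV mulmx1.
rewrite !det_mulmx mulrCA -det_mulmx -gmxM mulVg gmx1 det1.
by rewrite mulr1.
Qed.

Lemma ncomm_le2 g : nfix g = 0 -> (ncomm g <= 2)%N.
Proof.
move=> fg; rewrite /ncomm; case: (set_0Vmem [set x in K | g \in 'C[x]%g]) => [-> | [x]].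
  by rewrite cards0.
case/setIdP=> Kx cx.
pose Y := (\tr (gmx x))%:M - gmx x; pose y := gl2 (Y 0 0) (Y 0 1) (Y 1 0) (Y 1 1).
apply: (@leq_trans #|[set x; y]|); last by rewrite cards2; case: (_ != _).
apply/subset_leq_card/subsetP=> x' /setIdP[Kx' cx']; rewrite in_set2.
have [T D] := class_tr_det Kx; have [T' D'] := class_tr_det Kx'.
have c u : g \in 'C[u]%g -> gmx u *m gmx g = gmx g *m gmx u.
  by rewrite cent1_gmx eq_sym => /eqP.
have := elliptic_roots fg (c _ cx) (c _ cx'); rewrite T T' D D'.
case=> // [/gmx_inj-> | E]; first by rewrite eqxx.
by rewrite [x']gl2E E /y /Y T eqxx orbT.
Qed.

Lemma sum_ncomm (phi : {'GL_2[F]} -> algC) :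
  (forall g y, phi (g ^ y)%g = phi g) ->
  \sum_(g in elliptics) (ncomm g)%:R * phi g =
  q%:R * (q%:R - 1) * \sum_(g in 'C[g0]%g :\: Z) phi g.
Proof.
move=> phiJ.
transitivity (\sum_(g in elliptics) \sum_(x in K | g \in 'C[x]%g) phi g).
  apply: eq_bigr => g _; rewrite sumr_const mulr_natl; congr (_ *+ _).
  by apply: eq_card => x; rewrite in_set.
rewrite (exchange_big_dep (mem K)) /=; last by move=> g x _ /andP[].
transitivity (\sum_(x in K) \sum_(g in 'C[g0]%g :\: Z) phi g); last first.
  by rewrite sumr_const card_ell_class -q_pred -natrM mulr_natl.
apply: eq_bigr => x Kx; have fx := ell_class Kx.
rewrite (eq_bigl (mem ('C[x]%g :\: Z))) => [|g]; last first.
  by rewrite -(ell_cent_noncentral fx) Kx /= [RHS]in_set.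
case/imsetP: Kx => y _ ->.
rewrite (reindex_inj (conjg_inj y)) /=; apply: eq_big => [g | g _]; last exact: phiJ.
by rewrite !in_setD center_conj cent1J memJ_conjg.
Qed.

(** ncomm is at most 2 on elliptic elements, and double counting shows that its
    sum over them is twice their number. In particular all nonsplit tori are
    conjugate, which reflects that any two quadratic extensions of F are
    isomorphic. *)
Lemma ncomm2 g : nfix g = 0 -> ncomm g = 2.
Proof.
move=> fg; have le2 h : h \in elliptics -> (ncomm h <= 2 ?= iff (ncomm h == 2))%N.
  by rewrite inE => /eqP fh; apply/leqif_eq/ncomm_le2.
have [_ /esym] := leqif_sum le2.
have -> : (\sum_(h in elliptics) ncomm h = \sum_(h in elliptics) 2)%N.
  apply/eqP; rewrite -(eqr_nat algC) natr_sum sum_nat_const mulnC card_elliptics.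
  have := sum_ncomm (phi := fun=> 1) (fun _ _ => erefl).
  rewrite sumr_const card_ell_cent_noncentral // natrX natrM q_pred => E.
  by apply/eqP; rewrite expr2 -{}E; apply: eq_bigr => h _; rewrite mulr1.
rewrite eqxx => /forall_inP/(_ g); rewrite inE fg eqxx => /(_ isT) /eqP.
exact.
Qed.

(** So (nfix - 1) * (nfix - 2) is the character induced from the principal
    character of the nonsplit torus 'C[g0]. *)
Lemma sum_nonsplit (phi : {'GL_2[F]} -> algC) :
    (forall g y, phi (g ^ y)%g = phi g) ->
  \sum_g phi g * (((nfix g)%:R - 1) * ((nfix g)%:R - 2)) =
  q%:R * (q%:R - 1) * \sum_(g in 'C[g0]%g) phi g.
Proof.
move=> phiJ; rewrite sum_elliptics.
rewrite [in RHS](big_setID Z) /= (setIidPr (Z_sub_cent1 g0)).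
rewrite [RHS]mulrDr -sum_ncomm // addrC; congr (_ + _).
rewrite mulr_sumr; apply: eq_bigr => g; rewrite inE => /eqP fg.
by rewrite ncomm2.
Qed.

End NonsplitTorus.
End Count.

(** * Subgroups of GL2 *)

Section GLgroups.
Variable F : finFieldType.
Implicit Types (a b c d x y : F) (g h z : {'GL_2[F]}).
Local Notation q := #|F|.
Local Notation G := 'GL_2[F].

Definition unip : {set {'GL_2[F]}} := [set lowmx 1 x 1 | x : F].

Lemma unipM x y : (lowmx 1 x 1 * lowmx 1 y 1)%g = lowmx 1 (x + y) 1 :> {'GL_2[F]}.
Proof. by rewrite lowmxM ?oner_eq0 // !(mulr1, mul1r). Qed.

Lemma unip_group_set : group_set unip.
Proof.
apply/group_setP; split=> [|g h /imsetP[x _ ->] /imsetP[y _ ->]].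
  by rewrite -(@lowmx1 F); apply: imset_f.
by rewrite unipM; apply: imset_f.
Qed.
Canonical unip_group := Group unip_group_set.

Lemma unip_inj : injective (fun x : F => lowmx 1 x 1).
Proof.
move=> x y /(congr1 (fun g => gmx g 1 0)).
by rewrite !lowmxE ?oner_eq0 // !mx2_entries.
Qed.

Lemma card_unip : #|unip| = q.
Proof. by rewrite card_imset //; apply: unip_inj. Qed.

Lemma unip_abelian : abelian unip.
Proof.
apply/centsP=> _ /imsetP[x _ ->] _ /imsetP[y _ ->].
by rewrite /commute !unipM addrC.
Qed.

Lemma borel_group_set : group_set (borel F).
Proof.
apply/group_setP; split=> [|g h]; first by rewrite inE gmx1 mxE.
rewrite !inE => /eqP g0 /eqP h0.
by rewrite gmxM mulmx2E g0 h0 mul0r mulr0 addr0.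
Qed.
Canonical borel_group := Group borel_group_set.

Lemma torus_group_set : group_set (torus F).
Proof.
apply/group_setP; split=> [|g h]; first by rewrite inE gmx1 !mxE !eqxx.
rewrite !inE => /andP[/eqP g0 /eqP g1] /andP[/eqP h0 /eqP h1].
by rewrite gmxM !mulmx2E g0 h0 g1 h1 !(mul0r, mulr0) !addr0 eqxx.
Qed.
Canonical torus_group := Group torus_group_set.

Lemma torus_abelian : abelian (torus F).
Proof.
apply/centsP=> g Tg h Th.
have [a [c [a0 c0 ->]]] := torusE Tg; have [a' [c' [a0' c0' ->]]] := torusE Th.
rewrite /commute !lowmxM //.
by congr (lowmx _ _ _); rewrite ?mul0r ?mulr0 // mulrC.
Qed.

Lemma card_borel : #|borel F|%:R = q%:R * (q%:R - 1) ^+ 2 :> algC.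
Proof. by rewrite -q_pred -sum_const_borel sumr_const. Qed.

(** N contains all lower and upper unipotent matrices, and Gaussian elimination
    writes any invertible matrix as a product of such matrices and a diagonal one.
    Hence G / N is a quotient of the abelian group torus. *)
Lemma der1_sub_normal (N : {group {'GL_2[F]}}) :
  N <| G -> unip \subset N -> (G^`(1)%g \subset N)%g.
Proof.
move=> nsNG sUN; have [sNG nNG] := andP nsNG.
have NL x : lowmx 1 x 1 \in N by rewrite (subsetP sUN) //; apply: imset_f.
pose w : {'GL_2[F]} := gl2 0 1 1 0.
have wE : gmx w = mx2 0 1 1 0 by rewrite gl2K // mul0r mulr1 sub0r oppr_eq0 oner_eq0.
pose up x : {'GL_2[F]} := gl2 1 x 0 1.
have upE x : gmx (up x) = mx2 1 x 0 1 by rewrite gl2K // mulr0 mulr1 subr0 oner_eq0.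
have NU x : up x \in N.
  have -> : up x = (lowmx 1 x 1 ^ w)%g.
    apply: (mulgI w); rewrite /conjg mulKVg; apply: gmx_inj.
    rewrite !gmxM wE upE lowmxE ?oner_eq0 // !mulmx2.
    by rewrite !(mul0r, mulr0, mul1r, mulr1, addr0, add0r).
  by rewrite memJ_norm // (subsetP nNG) ?inE.
pose T := torus_group.
have gNT : (N * T)%g = (N <*> T)%g.
  by rewrite norm_joinEr // (subset_trans _ nNG) // subsetT.
have sN g : g \in N -> g \in (N <*> T)%g by apply/subsetP/joing_subl.
have NT1 g : gmx g 0 0 != 0 -> g \in (N * T)%g.
  set a := gmx g 0 0; set b := gmx g 0 1; set c := gmx g 1 0; set d := gmx g 1 1 => a0.
  (* g = L D U, where D has the entries a and det g / a. *)
  have e0 : d - c * b / a != 0.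
    have: a * (d - c * b / a) != 0; last by rewrite mulf_eq0 negb_or => /andP[].
    by rewrite mulrBr mulrCA divff // mulr1 [c * b]mulrC GL_det_neq0.
  have -> : g = (lowmx 1 (c / a)%R 1 * (lowmx a 0 (d - c * b / a)%R * up (b / a)%R))%g.
    apply: gmx_inj; rewrite !gmxM upE !lowmxE ?oner_eq0 // !mulmx2.
    by rewrite {1}[gmx g]mx2E; congr mx2; rewrite -/a -/b -/c -/d; field.
  have sT : lowmx a 0 (d - c * b / a)%R \in T by rewrite inE lowmxE // !mx2_entries !eqxx.
  rewrite gNT; apply: groupM; first exact/sN/NL.
  by apply: groupM; [apply: (subsetP (joing_subr N T)) | exact/sN/NU].
have sGNT : G \subset (N * T)%g.
  apply/subsetP=> g _; have [a0 | /NT1 //] := eqVneq (gmx g 0 0) 0.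
  have c0 : gmx g 1 0 != 0.
    by have := GL_det_neq0 g; apply: contraNneq => c0; rewrite a0 c0 mul0r mulr0 subrr.
  (* Adding the second row to the first one makes the corner nonzero. *)
  have : (up 1%R * g)%g \in (N * T)%g.
    apply: NT1; rewrite gmxM upE [gmx g]mx2E mulmx2 mx2_entries a0.
    by rewrite mulr0 add0r mul1r.
  rewrite gNT => ug; rewrite -(mulKg (up 1%R) g).
  by apply: groupM ug; apply: groupVr; apply: sN; apply: NU.
apply: der1_min => //.
suff -> : (G / N = T / N)%g by rewrite quotient_abelian ?torus_abelian.
apply/eqP; rewrite eqEsubset -{1}(quotientMidl N T); apply/andP; split.
  exact: quotientS.
by apply/quotientS/subsetT.
Qed.

End GLgroups.

(** * Irreducible characters trivial on the center *)

Section Irreducible.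
Variable F : finFieldType.
Implicit Types (g h z y : {'GL_2[F]}).
Local Notation q := #|F|.
Local Notation Q := (#|F|%:R : algC).
Local Notation G := 'GL_2[F].
Local Notation Z := 'Z('GL_2[F])%g.
Local Notation u := (lowmx 1 1 1 : {'GL_2[F]}).

Lemma Q_neq0 : Q != 0.
Proof. by rewrite pnatr_eq0 -lt0n ltnW // q_gt1. Qed.

Lemma Q_sub1_neq0 : Q - 1 != 0.
Proof. by rewrite -q_pred pnatr_eq0 -lt0n -subn1 subn_gt0 q_gt1. Qed.

Lemma Q_add1_neq0 : Q + 1 != 0.
Proof. by rewrite -q_succ pnatr_eq0. Qed.

Variable psi : 'CF('GL_2[F]).
Hypothesis irr_psi : psi \in irr 'GL_2[F].
Hypothesis kerZ : Z \subset cfker psi.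

Lemma psiJ g y : psi (g ^ y)%g = psi g.
Proof. by rewrite cfunJ ?inE. Qed.

Lemma psiZ z g : z \in Z -> psi (z * g)%g = psi g.
Proof. by move=> Zz; rewrite cfkerMl ?(subsetP kerZ). Qed.

Let Npsi : psi \is a character. Proof. exact: irrWchar. Qed.

(** psi takes a single value on the nontrivial elements of unip. *)
Lemma sum_unip (w : {'GL_2[F]} -> algC) : w 1%g = 1 ->
  \sum_(g in unip F) psi g * w g =
  psi 1%g - psi u + psi u * \sum_(g in unip F) w g.
Proof.
move=> w1; have inj := @unip_inj F; rewrite !big_imset /=; try by move=> x y _ _ /inj.
rewrite (bigD1 0) //= [X in _ = _ + _ * X](bigD1 0) //= lowmx1 w1 mulr1 mulrDr mulr1.
rewrite addrA subrK; congr (_ + _); rewrite mulr_sumr; apply: eq_bigr => x x0.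
by rewrite (phi_lowmx_eq psiJ psiZ) ?oner_eq0 // (negPf x0).
Qed.

(** d is the multiplicity in psi of any nontrivial character of unip. *)
Lemma unip_mult : exists d : nat, psi 1%g = psi u + Q * d%:R.
Proof.
have U1 : unip F != [1] :> {set _}.
  by rewrite -cardG_gt1 /= card_unip q_gt1.
have Nirr1 : (1 < Nirr (unip_group F))%N by rewrite NirrE classes_gt1.
pose i : Iirr (unip_group F) := Ordinal Nirr1.
have lin_i : 'chi_i \is a linear_char by apply/char_abelianP; apply: unip_abelian.
have i0 : 'chi_i != 1 by rewrite -irr0 (inj_eq irr_inj).
have sU : unip F \subset G by apply: subsetT.
have /natrP[d Ed] : '['Res[unip_group F] psi, 'chi_i] \in Num.nat.
  by rewrite Cnat_cfdot_char ?cfRes_char ?irr_char.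
exists d; rewrite -Ed cfdotE /= card_unip mulVKf ?Q_neq0 //.
rewrite (eq_bigr (fun g => psi g * ('chi_i g)^*)) => [|g Ug]; last by rewrite cfResE.
rewrite (@sum_unip (fun g => ('chi_i g)^*)); last by rewrite lin_char1 ?rmorph1.
rewrite -rmorph_sum /= sum_irr_neq1 ?mem_irr // rmorph0 mulr0 addr0.
by rewrite addrC subrK.
Qed.

(** a, m and d are the multiplicities in psi of the principal characters of unip
    and of borel, and of any nontrivial character of unip. *)
Lemma restriction_numbers : exists a d m : nat,
  [/\ psi u = a%:R - d%:R, psi 1%g = a%:R + (Q - 1) * d%:R,
      \sum_(g in unip F) psi g = Q * a%:R
    & \sum_(g in borel F) psi g = Q * (Q - 1) ^+ 2 * m%:R].
Proof.
have [d Ed] := unip_mult.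
have [a Ea] := sum_char_nat Npsi (subsetT (unip_group F)).
have [m Em] := sum_char_nat Npsi (subsetT (borel_group F)).
rewrite /= card_unip in Ea; rewrite /= card_borel in Em.
have Eu : psi u = a%:R - d%:R.
  have := @sum_unip (fun=> 1) erefl; rewrite sumr_const card_unip.
  rewrite (eq_bigr psi) => [|g _]; last by rewrite mulr1.
  rewrite Ea Ed => E; apply: (mulfI Q_neq0); rewrite mulrBr E; ring.
exists a, d, m; split=> //; by rewrite Ed Eu; ring.
Qed.

(** As the torus has (q - 1) ^ 2 elements, m + d is the multiplicity of its
    principal character in psi. *)
Lemma sum_torus_psi (d m : nat) :
    psi 1%g = psi u + Q * d%:R ->
    \sum_(g in borel F) psi g = Q * (Q - 1) ^+ 2 * m%:R ->
  \sum_(g in torus F) psi g = (Q - 1) ^+ 2 * (m%:R + d%:R).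
Proof.
move=> Ed Em; apply: (mulfI Q_neq0).
by rewrite (q_sum_torus psiJ psiZ) Em Ed; ring.
Qed.

(** Expand (f - 1) (f - 2) = f (f - 1) - 2 f + 2, and push the first two terms
    down to borel. *)
Lemma sum_nonsplit_expand (phi : {'GL_2[F]} -> algC) (g0 : {'GL_2[F]}) :
    (forall g y, phi (g ^ y)%g = phi g) ->
    (forall z g, z \in Z -> phi (z * g)%g = phi g) -> nfix g0 = 0 ->
  Q * (Q - 1) * \sum_(g in 'C[g0]%g) phi g =
  (Q + 1) * ((Q - 1) ^+ 2 * (phi 1%g - phi u) - \sum_(g in borel F) phi g)
  + 2 * \sum_g phi g.
Proof.
move=> phiJ phiZ fg0; rewrite -(sum_nonsplit fg0 phiJ).
transitivity (\sum_g phi g * ((nfix g)%:R * ((nfix g)%:R - 1))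
   + (- 2) * (\sum_g phi g * (nfix g)%:R) + 2 * \sum_g phi g).
  rewrite !mulr_sumr -!big_split /=; apply: eq_bigr => g _; ring.
rewrite sum_nfix2 // sum_nfix // q_succ -mulrA q_sum_torus //; ring.
Qed.

(** Since psi sums to 0 over G, only m and d enter in sum_nonsplit_expand. As the
    torus has q ^ 2 - 1 elements, d - m is the multiplicity of its principal
    character in psi. *)
Lemma sum_nonsplit_psi (g0 : {'GL_2[F]}) (d m : nat) :
    psi != 1 -> nfix g0 = 0 -> psi 1%g = psi u + Q * d%:R ->
    \sum_(g in borel F) psi g = Q * (Q - 1) ^+ 2 * m%:R ->
  \sum_(g in 'C[g0]%g) psi g = (Q + 1) * (Q - 1) * (d%:R - m%:R).
Proof.
move=> n1 fg0 Ed Em; apply: (mulfI (mulf_neq0 Q_neq0 Q_sub1_neq0)).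
have s0 : \sum_g psi g = 0.
  rewrite -[RHS](sum_irr_neq1 irr_psi n1); apply: eq_bigl => g; by rewrite inE.
by rewrite (sum_nonsplit_expand psiJ psiZ) // s0 Em Ed; ring.
Qed.

(** The kernel of psi contains unip, hence the derived subgroup of G. *)
Lemma linear_of_unip_trivial : psi 1%g = psi u -> psi \is a linear_char.
Proof.
move=> E; case/irrP: (irr_psi) => i Ei; rewrite Ei lin_irr_der1 -Ei.
apply: (@der1_sub_normal F (cfker_group psi)); first exact: cfker_normal.
apply/subsetP=> _ /imsetP[x _ ->]; rewrite /= cfkerEchar // !inE /=.
by rewrite (phi_lowmx_eq psiJ psiZ) ?oner_eq0 //; case: ifP; rewrite ?E.
Qed.

(** nfix has norm 2, and contains the principal character once and psi m times.
    So psi - (nfix - 1) has norm 2 - 2 m, which is at most 0. *)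
Lemma steinberg_of_borel (m : nat) : psi != 1 -> (0 < m)%N ->
    \sum_(g in borel F) psi g = Q * (Q - 1) ^+ 2 * m%:R ->
  forall g, psi g = (nfix g)%:R - 1.
Proof.
move=> n1 m_gt0 Em.
have s0 : \sum_g psi g = 0.
  rewrite -[RHS](sum_irr_neq1 irr_psi n1); apply: eq_bigl => g; by rewrite inE.
have norm1 : \sum_g psi g * (psi g)^* = #|G|%:R.
  rewrite -(sum_irr_norm irr_psi); apply: eq_bigl => g; by rewrite inE.
have sf := sum_nfix psiJ; rewrite Em q_succ in sf.
have E0 : \sum_g psi g * ((nfix g)%:R - 1) = #|G|%:R * m%:R.
  transitivity (\sum_g psi g * (nfix g)%:R + (-1) * \sum_g psi g).
    by rewrite mulr_sumr -big_split /=; apply: eq_bigr => g _; ring.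
  by rewrite s0 sf card_GL_C; ring.
have E1 : \sum_g (psi g)^* * ((nfix g)%:R - 1) = #|G|%:R * m%:R.
  rewrite -[RHS]conjCK rmorphM !rmorph_nat -E0 rmorph_sum; apply: eq_bigr => g _.
  by rewrite rmorphM rmorphB rmorph_nat rmorph1.
have E2 : \sum_(g : {'GL_2[F]}) ((nfix g)%:R - 1) ^+ 2 = #|G|%:R :> algC.
  have t2 := @sum_nfix2 F (fun=> 1) (fun _ _ => erefl) (fun _ _ _ => erefl).
  have t1 := @sum_nfix F (fun=> 1) (fun _ _ => erefl).
  have t3 := @q_sum_torus F (fun=> 1) (fun _ _ => erefl) (fun _ _ _ => erefl).
  rewrite sum_const_borel q_pred subrr mulr0 addr0 in t3.
  rewrite sum_const_borel q_pred q_succ in t1; rewrite -mulrA t3 in t2.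
  transitivity (\sum_(g : {'GL_2[F]}) 1 * ((nfix g)%:R * ((nfix g)%:R - 1)) +
     (-1) * (\sum_(g : {'GL_2[F]}) 1 * (nfix g)%:R)
     + \sum_(g : {'GL_2[F]}) 1 : algC).
    by rewrite mulr_sumr -!big_split /=; apply: eq_bigr => g _; ring.
  have t0 : \sum_(g : {'GL_2[F]}) 1 = #|G|%:R :> algC by rewrite sumr_const cardsT.
  by rewrite t1 t2 t0 card_GL_C; ring.
pose delta g := psi g - ((nfix g)%:R - 1).
have Ed : \sum_g delta g * (delta g)^* = #|G|%:R * (2 - 2 * m%:R).
  transitivity (\sum_g psi g * (psi g)^* + (-1) * (\sum_g psi g * ((nfix g)%:R - 1))
    + (-1) * (\sum_g (psi g)^* * ((nfix g)%:R - 1))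
    + \sum_(g : {'GL_2[F]}) ((nfix g)%:R - 1) ^+ 2).
    rewrite !mulr_sumr -!big_split /=; apply: eq_bigr => g _.
    by rewrite /delta !rmorphB rmorph_nat rmorph1; ring.
  by rewrite norm1 E0 E1 E2; ring.
have pos g : true -> 0 <= delta g * (delta g)^* by move=> _; apply: mul_conjC_ge0.
have sum0 : \sum_g delta g * (delta g)^* == 0.
  rewrite eq_le sumr_ge0 // andbT Ed mulr_ge0_le0 ?ler0n // subr_le0.
  by rewrite ler_peMr // ler1n.
move=> g; apply/eqP; rewrite -subr_eq0 -mul_conjC_eq0.
by rewrite psumr_eq0 // in sum0; move/allP: sum0 => /(_ g (mem_index_enum _)).
Qed.

(** Let psi have no vector fixed by unip, and let S be a nonsplit torus. The norm of
    psi on S is computed from sum_nonsplit_expand, applied to |psi| ^ 2. It follows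
    that theta, which is d times the regular character of S / Z minus psi, has norm
    at most 2. But theta has degree d (q + 1) - d (q - 1) = 2 d, which is at most
    its norm since theta is a virtual character of an abelian group. *)
Lemma cuspidal_mult_le1 (d : nat) :
  psi u = - d%:R -> psi 1%g = (Q - 1) * d%:R -> (d <= 1)%N.
Proof.
move=> Eu E1; have [g0 f0] := elliptic_exists F.
pose phi g := psi g * (psi g)^*.
have phiJ g y : phi (g ^ y)%g = phi g by rewrite /phi psiJ.
have phiZ z g : z \in Z -> phi (z * g)%g = phi g by move=> Zz; rewrite /phi psiZ.
have phi1 : phi 1%g = ((Q - 1) * d%:R) ^+ 2.
  by rewrite /phi E1 rmorphM rmorphB !rmorph_nat rmorph1 expr2.
have phiu : phi u = d%:R ^+ 2 by rewrite /phi Eu rmorphN rmorph_nat mulrNN expr2.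
have norm1 : \sum_g phi g = #|G|%:R.
  by rewrite -(sum_irr_norm irr_psi); apply: eq_bigl => g; rewrite inE.
have D_ge0 : 0 <= diag_sum phi.
  by apply: sumr_ge0 => a _; apply: sumr_ge0 => c _; apply: mul_conjC_ge0.
have SS := sum_nonsplit_expand phiJ phiZ f0.
rewrite norm1 card_GL_C (sum_borel phiJ phiZ) q_pred phi1 phiu in SS.
pose S := 'C[g0]%G; have cSS : abelian S := elliptic_cent_abelian f0.
have sZS : Z \subset S := Z_sub_cent1 g0.
have nsZS : Z <| S by rewrite /normal sZS (sub_abelian_norm cSS).
pose theta := d%:R *: 'Ind[S, center_group 'GL_2[F]] 1 - 'Res[S] psi.
have thetaE h : h \in S -> theta h = d%:R * (Q + 1) * (h \in Z)%:R - psi h.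
  move=> Sh; rewrite !cfunE cfResE ?subsetT // cfInd_cfun1 // cfunE cfuniE //.
  congr (_ - _); rewrite -!mulrA; congr (_ * (_ * _)).
  have Z0 : #|Z|%:R != 0 :> algC by rewrite card_Z q_pred Q_sub1_neq0.
  apply: (mulfI Z0); rewrite -natrM Lagrange // card_elliptic_cent_C // card_Z q_pred.
  by rewrite mulrC.
have Vtheta : theta \in 'Z[irr S].
  by rewrite rpredB ?char_vchar ?cfRes_char ?rpredZ_nat ?cfInd_char ?rpred1.
have theta1 : theta 1%g = 2 * d%:R.
  by rewrite thetaE ?group1 // mulr1 E1; ring.
have norm_theta : (Q + 1) * (Q - 1) * '[theta] =
    (Q - 1) * (d%:R ^+ 2 * (Q + 1) ^+ 2 - 2 * (d%:R * (Q + 1)) * ((Q - 1) * d%:R))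
    + \sum_(g in S) phi g.
  rewrite cfdotE -(card_elliptic_cent_C f0) mulVKf; last first.
    by rewrite card_elliptic_cent_C // mulf_neq0 ?Q_add1_neq0 ?Q_sub1_neq0.
  rewrite (big_setID Z) /= [X in _ = _ + X](big_setID Z) /= addrA (setIidPr sZS).
  congr (_ + _); last first.
    apply: eq_bigr => h /setDP[Sh /negPf nZ].
    by rewrite thetaE // nZ mulr0 sub0r rmorphN mulrNN.
  rewrite (eq_bigr (fun=> (2 * d%:R) * (2 * d%:R))) => [|z Zz].
    rewrite [X in _ = _ + X](eq_bigr (fun=> phi 1%g)) => [|z Zz]; last first.
      by rewrite -[z]mulg1 phiZ.
    have nat_l (x : algC) : x *+ q.-1 = (Q - 1) * x by rewrite -q_pred mulr_natl.
    by rewrite !sumr_const card_Z phi1 !nat_l; ring.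
  rewrite -theta1 !thetaE ?group1 ?(subsetP sZS) // Zz.
  rewrite -[z]mulg1 psiZ // E1 !(rmorphB, rmorphM, rmorphD, rmorph_nat, rmorph1) //=.
have norm_le2 : '[theta] <= 2.
  (* diag_sum phi is the contribution to |psi| ^ 2 of the regular diagonal elements. *)
  have E : (Q - 1) ^+ 2 * '[theta] = (Q - 1) ^+ 2 * 2 - diag_sum phi.
    apply: (mulfI (mulf_neq0 Q_neq0 Q_add1_neq0)).
    transitivity (Q * (Q - 1) * ((Q + 1) * (Q - 1) * '[theta])); first by ring.
    by rewrite norm_theta mulrDr SS; ring.
  have Q2 : 0 < (Q - 1) ^+ 2.
    by rewrite exprn_gt0 // -q_pred ltr0n -subn1 subn_gt0 q_gt1.
  by rewrite -(ler_pM2l Q2) E gerBl.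
have := le_trans (vchar_abelian_deg_le cSS Vtheta) norm_le2.
by rewrite theta1 -natrM ler_nat; lia.
Qed.

End Irreducible.

(** * Unisingular characters of PGL2 *)

Section PGL2Characters.
Variable F : finFieldType.
Implicit Types (g h z y : {'GL_2[F]}).
Local Notation q := #|F|.
Local Notation Q := (#|F|%:R : algC).
Local Notation G := 'GL_2[F].
Local Notation Z := 'Z('GL_2[F])%g.
Local Notation u := (lowmx 1 1 1 : {'GL_2[F]}).

Lemma nsZG : Z <| G. Proof. exact: center_normal. Qed.

Lemma NZ g : g \in 'N(Z)%g.
Proof. by apply: (subsetP (normal_norm nsZG)); rewrite inE. Qed.

Lemma u_expn n : (u ^+ n)%g = lowmx 1 n%:R 1.
Proof.
elim: n => [|n IHn]; first by rewrite expg0 lowmx1.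
by rewrite expgS IHn unipM -natr1 addrC.
Qed.

Lemma unip_u : u \in unip F. Proof. exact: imset_f. Qed.

Lemma u_neq1 : u != 1%g.
Proof.
rewrite -(@lowmx1 F); apply/eqP=> /(@unip_inj F) /eqP; by rewrite oner_eq0.
Qed.

Lemma order_u_prime : prime #[u].
Proof.
have [p p_pr pF] := finPcharP F.
have up : (u ^+ p)%g = 1%g by rewrite u_expn (pcharf0 pF) lowmx1.
by rewrite (nt_prime_order p_pr up u_neq1).
Qed.

Lemma cycle_u_sub : <[u]> \subset unip F.
Proof. by rewrite -[unip F]/(gval (unip_group F)) cycle_subG unip_u. Qed.

Lemma cycle_u_prime : prime q -> <[u]> = unip F.
Proof.
move=> q_pr; apply/eqP; rewrite eqEcard cycle_u_sub /= card_unip.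
have u_pr := order_u_prime; have := @cardSg _ (unip_group F) <[u]>%G cycle_u_sub.
by rewrite /= card_unip dvdn_prime2 // => /eqP <-.
Qed.

(** The sums of characters are computed in GL2, so representations of PGL2 F are
    inflated to GL2. *)
Section Lift.
Variables (n : nat) (rG : mx_representation algC (PGL2 F) n).
Let psi : 'CF('GL_2[F]) := (cfRepr rG %% Z)%CF.

Lemma GLsubN : [set: {'GL_2[F]}] \subset 'N(Z)%g.
Proof. exact: (normal_norm nsZG). Qed.

Let rL : mx_representation algC 'GL_2[F] n :=
  @morphim_repr _ _ _ 'GL_2[F]%G _ (coset_morphism Z) n rG GLsubN.

Lemma rLE g : rL g = rG (coset Z g). Proof. by []. Qed.

Lemma cfRepr_rL : cfRepr rL = psi.
Proof. exact: cfRepr_morphim. Qed.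

Lemma eigenvalue1_coset (H : {group {'GL_2[F]}}) g :
  g \in H -> \sum_(h in H) psi h != 0 -> eigenvalue (rG (coset Z g)) 1.
Proof.
move=> Hg nz; rewrite -rLE; apply: (eigenvalue1_sum (subsetT H) Hg).
by rewrite cfRepr_rL.
Qed.

Lemma sum_cycle_coset_neq0 g :
  eigenvalue (rG (coset Z g)) 1 -> \sum_(h in <[g]>) psi h != 0.
Proof.
by rewrite -rLE => /(sum_cycle_neq0 (in_setT g)); rewrite cfRepr_rL.
Qed.

Lemma eigenvalue1_cosetJ g y :
  eigenvalue (rG (coset Z (g ^ y)%g)) 1 -> eigenvalue (rG (coset Z g)) 1.
Proof. by rewrite -!rLE; apply: eigenvalue1J; apply: in_setT. Qed.

End Lift.

Section Chi.
Variable chi : 'CF(PGL2 F).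
Hypothesis irr_chi : chi \in irr (PGL2 F).
Let psi : 'CF('GL_2[F]) := (chi %% Z)%CF.

Lemma lift_irr : psi \in irr 'GL_2[F].
Proof. by rewrite cfMod_irr ?nsZG. Qed.

Lemma lift_ker : Z \subset cfker psi.
Proof. exact: (cfker_mod chi nsZG). Qed.

Lemma liftE g : psi g = chi (coset Z g).
Proof. by rewrite cfModE ?nsZG // inE. Qed.

Lemma lift1 : psi 1%g = chi 1%g. Proof. exact: cfMod1. Qed.

Lemma PGL2P x : reflect (exists g, x = coset Z g) (x \in PGL2 F).
Proof.
apply: (iffP idP) => [/morphimP[g _ _ ->] | [g ->]]; first by exists g.
by rewrite mem_quotient ?inE.
Qed.

Lemma sum_cycle_u : \sum_(h in <[u]>) psi h = psi 1%g + (#[u].-1)%:R * psi u.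
Proof.
rewrite (big_setD1 1%g) //= (eq_bigr (fun=> psi u)) => [|h /setD1P[h1 uh]].
  rewrite sumr_const mulr_natl; congr (_ + _ *+ _).
  by rewrite [in RHS]/order [in RHS](cardsD1 1%g) group1.
have /imsetP[x _ Eh] := subsetP cycle_u_sub _ uh.
rewrite Eh (phi_lowmx_eq (psiJ psi) (psiZ lift_ker)) ?oner_eq0 //.
by have [x0 | //] := eqVneq x 0; move: h1; rewrite Eh x0 lowmx1 eqxx.
Qed.

(** In terms of the multiplicities a, m, d of restriction_numbers, an element of the
    torus has a fixed vector because m + d > 0. If m > 0 then psi is the Steinberg
    character, and otherwise elliptic elements have fixed vectors because
    d - m = d > 0. The unipotent u has one if a > 0; if a = 0 then psi sums to
    (q - #[u]) d over <[u]>, which vanishes only when q is prime, and then d = 1. *)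
Lemma nonlinear_cases : chi \isn't a linear_char ->
  [\/ chi 1%g = Q /\ is_steinberg chi,
      [/\ odd q, prime q & chi 1%g = Q - 1]
    | unisingular chi].
Proof.
move=> nl; have irr_psi := lift_irr; have kZ := lift_ker.
have nl_psi : psi \isn't a linear_char by rewrite cfMod_lin_charE ?nsZG.
have n1 : psi != 1.
  by apply: contraNneq nl_psi => ->; apply: rpred1.
have [a [d [m [Eu E1 Ea Em]]]] := restriction_numbers irr_psi kZ.
have Ed : psi 1%g = psi u + Q * d%:R by rewrite E1 Eu; ring.
have d_gt0 : (0 < d)%N.
  rewrite lt0n; apply: contraNneq nl_psi => d0.
  by apply: (linear_of_unip_trivial irr_psi kZ); rewrite Ed d0 mulr0 addr0.
have [m_gt0 | m0] := posnP m; last first.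
  constructor 1; have St := steinberg_of_borel irr_psi n1 m0 Em.
  split; first by rewrite -lift1 St nfix1 q_succ addrK.
  by move=> _ /PGL2P[g ->]; rewrite -liftE St card_proj_fix.
have [/andP[/eqP a0 /eqP uq] | not3] := boolP ((a == 0)%N && (#[u] == q)).
  constructor 2.
  have q_pr : prime q by rewrite -uq order_u_prime.
  have d1 : d = 1%N.
    apply/eqP; rewrite eqn_leq d_gt0 andbT.
    by apply: (cuspidal_mult_le1 irr_psi kZ); rewrite ?Eu ?E1 a0 ?sub0r ?add0r.
  have E1' : psi 1%g = Q - 1 by rewrite E1 a0 d1 add0r mulr1.
  split=> //; last by rewrite -lift1.
  have [q2 | //] := even_prime q_pr; case/negP: nl_psi.
  by rewrite qualifE /= irrWchar // E1' q2 -natr1 addrK eqxx.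
constructor 3; have /char_reprP[[n rG] Echi] := irrWchar irr_chi.
exists n, rG; split; first by rewrite Echi.
move=> _ /PGL2P[g ->].
have Epsi : (cfRepr rG %% Z)%CF = psi by rewrite /psi Echi.
have eigH (H : {group {'GL_2[F]}}) h :
    h \in H -> \sum_(k in H) psi k != 0 -> eigenvalue (rG (coset Z h)) 1.
  by rewrite -Epsi; apply: eigenvalue1_coset.
have d0 : d%:R != 0 :> algC by rewrite pnatr_eq0 -lt0n.
case: (nfix_conj_cases g) => [[y Ty] | [y [z Zz Ey]] | fg].
- apply: (eigenvalue1_cosetJ (y := y)); apply: (eigH (torus_group F)) => //=.
  rewrite (sum_torus_psi kZ Ed Em) mulf_neq0 ?expf_neq0 ?Q_sub1_neq0 //.
  by rewrite -natrD pnatr_eq0 addn_eq0 negb_and -lt0n -lt0n d_gt0 orbT.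
- apply: (eigenvalue1_cosetJ (y := y)); rewrite Ey morphM ?NZ //= (coset_id Zz) mul1g.
  have [a0 | a0] := eqVneq a 0%N; last first.
    by apply: (eigH (unip_group F)); rewrite ?unip_u //= Ea mulf_neq0 ?Q_neq0 // pnatr_eq0.
  apply: (eigH <[u]>%G); first exact: cycle_id.
  rewrite sum_cycle_u E1 Eu a0 -subn1 natrB ?order_gt0 //.
  have -> : 0%:R + (Q - 1) * d%:R + (#[u]%:R - 1) * (0%:R - d%:R) = (Q - #[u]%:R) * d%:R.
    by ring.
  rewrite mulf_neq0 // subr_eq0 eqr_nat eq_sym.
  by move: not3; rewrite a0 eqxx.
apply: (eigH 'C[g]%G); first exact: cent1id.
rewrite (sum_nonsplit_psi irr_psi kZ n1 fg Ed Em) m_gt0 subr0.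
by rewrite !mulf_neq0 ?Q_add1_neq0 ?Q_sub1_neq0.
Qed.

Lemma linear_not_unisingular : chi \is a linear_char -> chi != 1 -> ~ unisingular chi.
Proof.
move=> lin_chi n1 [n [rG [Echi uG]]]; case/negP: n1.
apply/eqP/cfun_inP=> x Gx; rewrite cfun1E Gx.
have := sum_cycle_neq0 Gx (uG x Gx); rewrite Echi; apply: contraNeq => chix.
have sxG : <[x]> \subset PGL2 F by rewrite cycle_subG.
rewrite (eq_bigr ('Res[<[x]>] chi)) => [|h xh]; last by rewrite cfResE.
rewrite sum_irr_neq1 ?lin_char_irr ?cfRes_lin_char //.
apply: contraNneq chix => R1; rewrite -(cfResE chi sxG (cycle_id x)) R1 cfun1E.
by rewrite cycle_id.
Qed.

Lemma not_unisingular_of_sum g :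
  \sum_(h in <[g]>) psi h = 0 -> ~ unisingular chi.
Proof.
move=> s0 [n [rG [Echi uG]]].
have /sum_cycle_coset_neq0 : eigenvalue (rG (coset Z g)) 1.
  by apply: uG; apply/PGL2P; exists g.
by rewrite Echi -/psi s0 eqxx.
Qed.

(** The Steinberg character is -1 at the noncentral elements of a nonsplit torus, and
    sums to 0 over it; a generator of the torus then has no fixed vector. *)
Lemma steinberg_not_unisingular : is_steinberg chi -> ~ unisingular chi.
Proof.
move=> St; have [g0 f0] := elliptic_exists F.
have [s Es] := cyclicP (elliptic_cent_cyclic f0).
apply: (@not_unisingular_of_sum s); rewrite -Es (big_setID Z) /=.
have psiE g : psi g = (nfix g)%:R - 1.
  by rewrite liftE St ?card_proj_fix //; apply/PGL2P; exists g.
rewrite (setIidPr (Z_sub_cent1 g0)) (eq_bigr (fun=> Q)) => [|z Zz]; last first.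
  by rewrite psiE nfix_center // q_succ addrK.
rewrite [X in _ + X](eq_bigr (fun=> -1)) => [|h /setDP[ch nZ]]; last first.
  by rewrite psiE (ell_comm f0 ch nZ) sub0r.
rewrite !sumr_const card_Z card_ell_cent_noncentral // mulNrn.
by rewrite mulrnA subrr.
Qed.

(** As psi 1 = a + (q - 1) d with d > 0, the degree forces a = 0; and unip is
    generated by u when q is prime. *)
Lemma cuspidal_not_unisingular : odd q -> prime q -> chi 1%g = Q - 1 ->
  ~ unisingular chi.
Proof.
move=> odd_q q_pr E; apply: (@not_unisingular_of_sum u); rewrite cycle_u_prime //.
have irr_psi := lift_irr; have kZ := lift_ker.
have [a [d [m [Eu E1 Ea _]]]] := restriction_numbers irr_psi kZ; rewrite Ea.
have q_gt2 : (2 < q)%N by apply: odd_prime_gt2.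
have d_gt0 : (0 < d)%N.
  rewrite lt0n; apply/negP=> /eqP d0.
  have /lin_char1 : psi \is a linear_char.
    by apply: (linear_of_unip_trivial irr_psi kZ); rewrite E1 Eu d0 mulr0 addr0 subr0.
  rewrite lift1 E => /eqP; rewrite subr_eq -[1 + 1]/(2%:R : algC) eqr_nat => /eqP q2.
  by rewrite q2 in q_gt2.
suff -> : a = 0%N by rewrite mulr0.
have: (a + q.-1 * d)%:R = q.-1%:R :> algC.
  by rewrite natrD natrM q_pred -E1 lift1 E.
by move/eqP; rewrite eqr_nat => /eqP; nia.
Qed.

End Chi.

End PGL2Characters.

Theorem proposition3p1 (q : nat) (F : finFieldType) (hq : #|F| = q)
    (chi : 'CF(PGL2 F)) (irr_chi : chi \in irr (PGL2 F)) :
  ~ unisingular chi <->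
  [\/ chi \is a linear_char /\ chi != 1,
      chi 1%g = q%:R /\ is_steinberg chi
    | [/\ odd q, prime q & chi 1%g = q%:R - 1]].
Proof.
subst q; split=> [nu | [[lin n1] | [_ St] | [oq pq E]]].
- have [lin | nl] := boolP (chi \is a linear_char).
    have [E1 | n1] := eqVneq chi 1; last by constructor 1.
    case: nu; have /char_reprP[[n rG] Echi] := irrWchar irr_chi.
    exists n, rG; split=> // g Gg; apply: (eigenvalue1_sum (H := PGL2 F)) => //.
    rewrite -Echi E1 (eq_bigr (fun=> 1)) => [|h Hh]; last by rewrite cfun1E Hh.
    by rewrite sumr_const pnatr_eq0 -lt0n cardG_gt0.
  by have [[D St] | D | /nu //] := nonlinear_cases irr_chi nl;
    [constructor 2 | constructor 3].
- exact: linear_not_unisingular.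
- exact: steinberg_not_unisingular.
exact: cuspidal_not_unisingular.
Qed.
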